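(* For every integer $k\ge 6$, $$\biggl\|\biggl(\frac43\biggr)^k\biggr\| > \biggl(\frac49\biggr)^k,$$ where for a real number $x$, $\|x\|$ denotes the distance from $x$ to the nearest integer.
   Context: $\|x\| = \min_{n\in\mathbb Z}|x-n|$ for real $x$. *)

(* Defs.v *)
From Stdlib Require Import Reals ZArith.
Open Scope R_scope.

(* Floor of a real number: up x is the least integer strictly greater than x. *)
Definition Rfloor (x : R) : Z := (up x - 1)%Z.

(* ||x|| = min_{n in Z} |x - n|, the distance from x to the nearest integer.
   The minimum is attained at floor x or floor x + 1. *)
Definition dist_Z (x : R) : R :=
  Rmin (Rabs (x - IZR (Rfloor x))) (Rabs (x - IZR (Rfloor x + 1))).

(* Main.v *)
(* Suppose 4 ^ k = 3 ^ k * X + s with |s| * 3 ^ k <= 4 ^ k, and write k = 60 m + r.  Pade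
   approximation of a power of 1 - z at z = 1/9 gives, for l = 23 m, n = 13 m and M = 30 m,
   integers P and Q and a remainder R > 0 with 9 ^ M * P = 8 ^ (l + M - n) * Q + (-1) ^ l * R.
   Since 4 ^ r * 8 ^ (l + M - n) = 4 ^ (2 M + r), the integer E = 4 ^ r * P - 3 ^ r * X * Q
   satisfies 9 ^ M * E = s * Q + (-1) ^ l * 4 ^ r * R; it is nonzero when m has the parity making
   both terms of the same sign.  P and Q have a large common divisor W, so that |E| >= W: every
   prime p with [53 m / p] - [23 m / p] - [17 m / p] - [13 m / p] >= 2 divides W.  When W is large
   enough the bounds on Q and R contradict |E| >= W.

   For m >= 2000, ln W is bounded below in the style of Chebyshev: a fixed integer combination of
   the floors [a y / b] lies below the indicator of the condition on p, up to a loss paid for by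
   psi(x) <= x ln 4, and Stirling's formula evaluates the corresponding combination of factorials.
   For 127 <= m < 2000, the primes dividing W are enumerated.  For k < 7680, a good approximation
   at k would make 4 ^ k0 abnormally close to a multiple of 3 ^ k1 for all k1 <= k <= k0 with
   k0 up to about 1.58 k1, so seventeen computations cover all cases. *)
Require Import Defs.
From Stdlib Require Import Reals ZArith Zpow_facts Bool Lra Lia.
From Stdlib Require List Sorted Factorial.
From Coquelicot Require Coquelicot.
From mathcomp Require all_boot all_order all_algebra reals Rstruct zify ring lra.

(** * Logarithms *)

Module LogarithmBounds.

Import Factorial Coquelicot.Coquelicot.
Local Open Scope R_scope.

(** The proportions obey M = 3 (l - n), which makes 8 ^ (l + M - n) the power of 4 that goes with 9
    ^ M = 3 ^ (2 M). The trivial bound |E| >= 1 proves nothing here: as |s| may be as large as (4 /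
    3) ^ k, the bound on |s| * Q / 9 ^ M grows like 2 ^ (5.971 m), and the one on R / 9 ^ M like 2 ^
    (5.78 m). All depends on the size of W, and the certificate gives it a growth of about 2 ^ (6.2
    m). This margin is thin. Stirling's formula is applied to signed factorials whose weights have
    total size 3982, which takes about 2000 ln m away from 60 ln W and consumes the margin until m
    is close to 2000: hence the threshold, and the enumeration of primes below it. A residue r costs
    log2 (4 / 3) bits per unit in the term with Q and 2 bits in the term with R; letting r run up to
    119 instead of 59 leaves the parity of m free. *)

Lemma nonneg_of_derive (f df : R -> R) (v : R) : 1 <= v ->
  (forall x, 1 <= x -> is_derive f x (df x)) -> (forall x, 1 <= x -> 0 <= df x) ->
  f 1 <= f v.
Proof.
intros v_ge1 der pos.
destruct (MVT_gen f 1 v df) as [c [hc e]].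
- intros x hx; apply der; rewrite Rmin_left, Rmax_right in hx by lra; lra.
- intros x hx; apply derivable_continuous_pt; exists (df x); apply is_derive_Reals, der.
  rewrite Rmin_left, Rmax_right in hx by lra; lra.
- rewrite Rmin_left, Rmax_right in hc by lra.
  assert (0 <= df c) by (apply pos; lra).
  assert (0 <= df c * (v - 1)) by (apply Rmult_le_pos; lra).
  lra.
Qed.

Lemma ln_ge_pade v : 1 <= v -> 2 * (v - 1) / (v + 1) <= ln v.
Proof.
intros v_ge1.
assert (h := nonneg_of_derive (fun v => ln v - 2 * (v - 1) / (v + 1))
  (fun v => (v - 1) ^ 2 / (v * (v + 1) ^ 2)) v v_ge1).
cbv beta in h; rewrite ln_1 in h.
enough (0 - 2 * (1 - 1) / (1 + 1) <= ln v - 2 * (v - 1) / (v + 1)) by lra.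
apply h.
- intros x hx; auto_derive; [lra|field; lra].
- intros x hx; apply Rdiv_le_0_compat; [apply pow2_ge_0|].
  apply Rmult_lt_0_compat; [lra|apply pow_lt; lra].
Qed.

Lemma ln_le_mean v : 1 <= v -> ln v <= (v - / v) / 2.
Proof.
intros v_ge1.
assert (h := nonneg_of_derive (fun v => (v - / v) / 2 - ln v)
  (fun v => (v - 1) ^ 2 / (2 * v ^ 2)) v v_ge1).
cbv beta in h; rewrite ln_1 in h.
enough ((1 - / 1) / 2 - 0 <= (v - / v) / 2 - ln v) by lra.
apply h.
- intros x hx; auto_derive; [lra|field; lra].
- intros x hx; apply Rdiv_le_0_compat; [apply pow2_ge_0|].
  apply Rmult_lt_0_compat; [lra|apply pow_lt; lra].
Qed.

Lemma stirling_bounds (n : nat) : (1 <= n)%nat ->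
  let x := INR n in
  x * ln x - x + ln x / 2 + 3 / 4 <= ln (INR (fact n)) <= x * ln x - x + ln x / 2 + 1.
Proof.
intros n_ge1 x.
(* With 1 / (4 x) added, both bounds are equalities at 1. Passing from x to x + 1 lowers ln (x!) -
   (x ln x - x + ln x / 2) by (x + 1/2) ln (1 + 1/x) - 1, which lies between 0 and the telescoping
   difference 1 / (4 x) - 1 / (4 (x + 1)). *)
enough (x * ln x - x + ln x / 2 + 3 / 4 + / (4 * x) <= ln (INR (fact n)) <=
  x * ln x - x + ln x / 2 + 1).
  assert (0 < / (4 * x)); [|lra].
  apply Rinv_0_lt_compat; assert (0 < x) by (apply lt_0_INR; lia); lra.
unfold x; clear x; induction n as [|n IH]; [lia|].
destruct n as [|n].
  simpl; rewrite ln_1; lra.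
specialize (IH ltac:(lia)).
change (fact (S (S n))) with ((S (S n)) * fact (S n))%nat.
rewrite mult_INR, ln_mult by (apply lt_0_INR; try apply lt_O_fact; lia).
rewrite (S_INR (S n)).
assert (x_ge1 : 1 <= INR (S n)) by (apply (le_INR 1); lia).
revert IH x_ge1; generalize (INR (S n)) as x, (ln (INR (fact (S n)))) as F; intros x F IH x_ge1.
assert (e : ln (x + 1) = ln x + ln (1 + / x)).
  rewrite <- ln_mult; [f_equal; field; lra|lra|].
  assert (0 < / x) by (apply Rinv_0_lt_compat; lra); lra.
assert (inv_pos : 0 < / x) by (apply Rinv_0_lt_compat; lra).
assert (lo := ln_ge_pade (1 + / x) ltac:(lra)).
assert (hi := ln_le_mean (1 + / x) ltac:(lra)).
replace (2 * (1 + / x - 1) / (1 + / x + 1)) with (2 / (2 * x + 1)) in lo by (field; lra).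
replace ((1 + / x - / (1 + / x)) / 2) with ((2 * x + 1) / (2 * (x * (x + 1)))) in hi by (field; lra).
assert (lo' : 1 <= (x + / 2) * ln (1 + / x)).
  replace 1 with ((x + / 2) * (2 / (2 * x + 1))) at 1 by (field; lra).
  apply Rmult_le_compat_l; lra.
assert (hi' : (x + / 2) * ln (1 + / x) <= 1 + / (4 * x) - / (4 * (x + 1))).
  replace (1 + / (4 * x) - / (4 * (x + 1))) with ((x + / 2) * ((2 * x + 1) / (2 * (x * (x + 1))))).
    apply Rmult_le_compat_l; lra.
  field; lra.
rewrite e; split; [|destruct IH; lra].
destruct IH; lra.
Qed.

Lemma ln_le_sub1 x : 0 < x -> ln x <= x - 1.
Proof.
intros x_gt0; destruct (Req_dec x 1) as [->|ne]; [rewrite ln_1; lra|].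
assert (h := exp_ineq1 (ln x)); rewrite exp_ln in h by assumption.
destruct (Req_dec (ln x) 0) as [e|e]; [|specialize (h e); lra].
exfalso; apply ne; rewrite <- (exp_ln x) by assumption; now rewrite e, exp_0.
Qed.

Lemma ln_floor_fact_upper (n : nat) (x : R) : (1 <= n)%nat -> INR n <= x ->
  ln (INR (fact n)) <= x * ln x - x + ln x / 2 + 1.
Proof.
intros n_ge1 le_nx; destruct (stirling_bounds n n_ge1) as [_ h].
assert (1 <= INR n) by (apply (le_INR 1); lia).
assert (le_ln : ln (INR n) <= ln x) by (destruct le_nx as [lt| ->]; [left; apply ln_increasing; lra|lra]).
assert (tangent : ln (INR n / x) <= INR n / x - 1).
  apply ln_le_sub1, Rdiv_lt_0_compat; lra.
unfold Rdiv in tangent; rewrite ln_mult, ln_Rinv in tangent by (try apply Rinv_0_lt_compat; lra).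
assert (0 <= ln (INR n)).
  rewrite <- ln_1; destruct (Req_dec 1 (INR n)) as [->|]; [lra|left; apply ln_increasing; lra].
assert (INR n * (ln x - ln (INR n)) >= 0) by (apply Rle_ge, Rmult_le_pos; lra).
assert ((x - INR n) * ln x >= 0) by (apply Rle_ge, Rmult_le_pos; lra).
assert (key : x * (ln (INR n) - ln x) <= INR n - x).
  replace (INR n - x) with (x * (INR n * / x - 1)) by (field; lra).
  apply Rmult_le_compat_l; lra.
assert (0 <= (x - INR n) * ln (INR n)) by (apply Rmult_le_pos; lra).
lra.
Qed.

(** Stirling's bound is taken at n + 1, which is at least x; dividing (n + 1)! by n + 1 turns + ln /
    2 into - ln / 2. The function t ln t - t - ln t / 2 increases for t >= 2, so n + 1 may be
    lowered to x. *)
Lemma ln_floor_fact_lower (n : nat) (x : R) : 2 <= x -> x <= INR n + 1 ->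
  x * ln x - x - ln x / 2 + 3 / 4 <= ln (INR (fact n)).
Proof.
intros x_ge2 le_xn.
assert (stir := proj1 (stirling_bounds (S n) ltac:(lia))).
change (fact (S n)) with (S n * fact n)%nat in stir.
rewrite mult_INR, ln_mult, S_INR in stir by (apply lt_0_INR; try apply lt_O_fact; lia).
revert stir le_xn; generalize (INR n + 1) as y; intros y stir le_xy.
assert (y_gt0 : 0 < y) by lra.
assert (tangent : ln (x / y) <= x / y - 1) by (apply ln_le_sub1, Rdiv_lt_0_compat; lra).
unfold Rdiv in tangent; rewrite ln_mult, ln_Rinv in tangent by (try apply Rinv_0_lt_compat; lra).
assert (tangent2 : ln (y / x) <= y / x - 1) by (apply ln_le_sub1, Rdiv_lt_0_compat; lra).
unfold Rdiv in tangent2; rewrite ln_mult, ln_Rinv in tangent2 by (try apply Rinv_0_lt_compat; lra).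
assert (key : y * (ln x - ln y) <= x - y).
  replace (x - y) with (y * (x * / y - 1)) by (field; lra).
  apply Rmult_le_compat_l; lra.
assert (key2 : ln y - ln x <= (y - x) / 2).
  apply Rle_trans with (1 := ltac:(lra) : ln y - ln x <= y * / x - 1).
  replace (y * / x - 1) with ((y - x) * / x) by (field; lra).
  apply Rmult_le_compat_l; [lra|]; apply Rinv_le_contravar; lra.
assert (half : / 2 <= ln x).
  apply Rle_trans with (ln 2); [left; exact ln_lt_2|].
  destruct x_ge2 as [lt| <-]; [left; apply ln_increasing; lra|lra].
assert ((y - x) * (ln x - / 2) >= 0) by (apply Rle_ge, Rmult_le_pos; lra).
lra.
Qed.

Lemma ln2_bounds : 2 / 3 <= ln 2 <= 1.
Proof.
assert (lo := ln_ge_pade 2 ltac:(lra)); assert (hi := ln_le_sub1 2 ltac:(lra)); lra.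
Qed.

(** The tangent of ln at 2000, the end of the range where the margin is thinnest, with log2 2000
    bounded through integer powers. *)
Lemma ln_tangent_2000 M : 0 < M -> ln M <= 1097 / 100 * ln 2 + (M / 2000 - 1).
Proof.
intros M_gt0.
assert (pows : ln (2000 ^ 100) <= ln (2 ^ 1097)).
  assert (h : (2000 ^ 100 <= 2 ^ 1097)%Z) by (apply Z.leb_le; vm_compute; reflexivity).
  change 100%Z with (Z.of_nat 100) in h; change 1097%Z with (Z.of_nat 1097) in h.
  apply IZR_le in h; rewrite <- (pow_IZR 2000 100), <- (pow_IZR 2 1097) in h.
  destruct h as [lt|eq]; [left; apply ln_increasing; [apply pow_lt; lra|exact lt]|right; now rewrite eq].
rewrite !ln_pow in pows by lra.
replace (INR 100) with 100 in pows by (rewrite INR_IZR_INZ; reflexivity).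
replace (INR 1097) with 1097 in pows by (rewrite INR_IZR_INZ; reflexivity).
assert (h := ln_le_sub1 (M / 2000) ltac:(lra)).
replace M with (2000 * (M / 2000)) at 1 by field; rewrite ln_mult by lra; lra.
Qed.

(** [W] stands for the logarithm of the common divisor. [Q] is the linear term carrying [balance],
    which cancels; 3982 and 1858 gather the lower-order terms of Stirling's formula, and [loss] is
    what psi(x) <= x ln 4 charges. The 51000 is kept to pay for the residue r. *)
Lemma content_rate_of_terms (M Q F1 F2 F3 W loss : R) :
  2000 <= M -> 4329 / 10 <= F1 -> - 1370 <= F2 -> F3 <= 605 / 20 ->
  - Q + M * ln 2 * F1 - 3982 * ln M / 2 + ln 2 / 2 * F2 - 1858 / 4 + (Q - 30 * ln M) <=
    60 * W + loss ->
  loss <= M * (2 * ln 2) * F3 ->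
  (5971 * M + 51000) * ln 2 <= 1000 * W.
Proof.
intros M_ge F1_ge F2_ge F3_le main loss_le.
destruct ln2_bounds as [L_lo L_hi]; assert (lm_le := ln_tangent_2000 M ltac:(lra)).
revert L_lo L_hi lm_le main loss_le; generalize (ln 2) as L, (ln M) as lm.
intros L lm L_lo L_hi lm_le main loss_le.
assert (ML_ge0 : 0 <= M * L) by (apply Rmult_le_pos; lra).
assert (h1 : M * L * (4329 / 10) <= M * L * F1) by (apply Rmult_le_compat_l; lra).
assert (h2 : L * - (1370) <= L * F2) by (apply Rmult_le_compat_l; lra).
assert (h3 : M * L * F3 <= M * L * (605 / 20)) by (apply Rmult_le_compat_l; lra).
assert (h4 : M * (2 / 3) <= M * L) by (apply Rmult_le_compat_l; lra).
assert (h5 : 2000 * L <= M * L) by (apply Rmult_le_compat_r; lra).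
lra.
Qed.

Lemma content_rate (M L Q lm W loss : R) :
  L = ln 2 -> lm = ln M -> 2000 <= M ->
  - Q + M * (L / 131072) * 56752510 - 3982 * lm / 2 + L / 131072 / 2 * - 179485679 +
    - 1858 / 4 + (Q - 30 * lm) <= 60 * W + loss ->
  loss <= M * (2 * L) / 131072 * 3962960 ->
  (5971 * M + 51000) * ln 2 <= 1000 * W.
Proof.
intros -> -> M_ge main loss_le.
apply (content_rate_of_terms M Q (56752510 / 131072) (- 179485679 / 131072) (3962960 / 131072) W loss M_ge);
  lra.
Qed.

End LogarithmBounds.

(** * Certified binary logarithms and the numerical contradictions *)

Module BinaryLogarithm.

Local Open Scope Z_scope.

(* Approximates 2 ^ j * (e + log2 (y / 2 ^ 40)) from below, for y in [2 ^ 40, 2 ^ 41). *)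
Fixpoint log2_digits (j : nat) (e y : Z) : Z :=
  match j with
  | O => e
  | S j' =>
    let h := Z.shiftr (y * y) 40 in
    if 2199023255552 <=? h then log2_digits j' (2 * e + 1) (Z.shiftr h 1)
    else log2_digits j' (2 * e) h
  end.

Definition log2_exponent (a b : Z) : Z := Z.log2 (Z.shiftl a 60 / b) - 60.
Definition log2_mantissa (a b : Z) : Z := Z.shiftl a (40 - log2_exponent a b) / b.
Definition log2_lower (j : nat) (a b : Z) : Z :=
  log2_digits j (log2_exponent a b) (log2_mantissa a b).
(** The exponent and the mantissa are guesses: correctness rests on the floor in the mantissa and on
    the inequalities tested here. *)
Definition log2_valid (a b : Z) : bool :=
  (0 <? a) && (0 <? b) && (log2_exponent a b <=? 40) && (1099511627776 <=? log2_mantissa a b).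

Local Open Scope R_scope.

Lemma ln_pow2 n : ln (2 ^ n) = INR n * ln 2.
Proof. rewrite ln_pow by lra; reflexivity. Qed.

Lemma ln_le x y : 0 < x -> x <= y -> ln x <= ln y.
Proof. intros x_gt0 [lt| ->]; [left; apply ln_increasing; lra|lra]. Qed.

Lemma two40 : 1099511627776 = 2 ^ 40.
Proof. simpl; ring. Qed.

Lemma log2_digits_lower (j : nat) : forall (t : R) e y, (1099511627776 <= y)%Z ->
  IZR e * ln 2 + ln (IZR y / 2 ^ 40) <= t ->
  IZR (log2_digits j e y) * ln 2 <= 2 ^ j * t.
Proof.
induction j as [|j IH]; intros t e y y_ge inv.
  simpl; assert (0 <= ln (IZR y / 2 ^ 40)); [|lra].
  rewrite <- ln_1; apply ln_le; [lra|].
  apply IZR_le in y_ge; rewrite two40 in y_ge.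
  apply Rmult_le_reg_r with (2 ^ 40); [apply pow_lt; lra|].
  unfold Rdiv; rewrite Rmult_assoc, Rinv_l by (apply pow_nonzero; lra); lra.
assert (dbl : forall z, ln z + ln z = 2 * ln z) by (intros; ring).
cbn [log2_digits].
rewrite Z.shiftr_div_pow2 by lia; change (2 ^ 40)%Z with 1099511627776%Z.
set (h := (y * y / 1099511627776)%Z).
assert (h_ge : (1099511627776 <= h)%Z) by (apply Z.div_le_lower_bound; nia).
assert (h_le : IZR h * 2 ^ 40 <= IZR y * IZR y).
  rewrite <- two40, <- !mult_IZR; apply IZR_le.
  pose proof (Z.mul_div_le (y * y) 1099511627776 ltac:(lia)); unfold h; lia.
assert (y_pos : 0 < IZR y) by (apply IZR_lt; lia).
assert (p_pos : 0 < 2 ^ 40) by (apply pow_lt; lra).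
assert (step : forall z, 0 < z -> z * 2 ^ 40 <= IZR y * IZR y ->
    ln (z / 2 ^ 40) <= 2 * ln (IZR y / 2 ^ 40)).
  intros z z_pos z_le; rewrite <- dbl, <- ln_mult; try (apply Rdiv_lt_0_compat; lra).
  apply ln_le; [apply Rdiv_lt_0_compat; lra|].
  apply Rmult_le_reg_r with (2 ^ 40 * 2 ^ 40); [nra|].
  replace (z / 2 ^ 40 * (2 ^ 40 * 2 ^ 40)) with (z * 2 ^ 40) by (field; lra).
  replace (IZR y / 2 ^ 40 * (IZR y / 2 ^ 40) * (2 ^ 40 * 2 ^ 40)) with (IZR y * IZR y) by (field; lra).
  exact z_le.
replace (2 ^ S j * t) with (2 ^ j * (2 * t)) by (simpl; ring).
destruct (Z.leb_spec 2199023255552 h) as [big|small].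
  rewrite Z.shiftr_div_pow2 by lia; change (2 ^ 1)%Z with 2%Z.
  assert (half_ge : (1099511627776 <= h / 2)%Z) by (apply Z.div_le_lower_bound; lia).
  apply IH; [exact half_ge|].
  assert (half_pos : 0 < IZR (h / 2)) by (apply IZR_lt; lia).
  assert (half_le : 2 * IZR (h / 2) <= IZR h).
    rewrite <- mult_IZR; apply IZR_le; apply Z.mul_div_le; lia.
  assert (s := step (2 * IZR (h / 2)) ltac:(lra) ltac:(nra)).
  replace (2 * IZR (h / 2) / 2 ^ 40) with (2 * (IZR (h / 2) / 2 ^ 40)) in s by (field; lra).
  rewrite ln_mult in s by (try (apply Rdiv_lt_0_compat); lra).
  rewrite plus_IZR, mult_IZR; lra.
apply IH; [exact h_ge|].
assert (h_pos : 0 < IZR h) by (apply IZR_lt; lia).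
assert (s := step (IZR h) h_pos h_le).
rewrite mult_IZR; lra.
Qed.

Lemma log2_lower_correct (j : nat) (a b : Z) : log2_valid a b = true ->
  IZR (log2_lower j a b) * ln 2 <= 2 ^ j * (ln (IZR a) - ln (IZR b)).
Proof.
unfold log2_valid, log2_lower; rewrite !Bool.andb_true_iff.
intros [[[a_pos b_pos] e_le] m_ge].
apply Z.ltb_lt in a_pos; apply Z.ltb_lt in b_pos; apply Z.leb_le in e_le; apply Z.leb_le in m_ge.
apply log2_digits_lower; [exact m_ge|].
revert m_ge; unfold log2_mantissa; set (e := log2_exponent a b) in *; clearbody e.
rewrite Z.shiftl_mul_pow2 by lia; intros m_ge.
set (y := (a * 2 ^ (40 - e) / b)%Z) in *.
assert (a_posR : 0 < IZR a) by (apply IZR_lt; lia).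
assert (b_posR : 0 < IZR b) by (apply IZR_lt; lia).
assert (y_posR : 0 < IZR y) by (apply IZR_lt; lia).
assert (p_pos : 0 < 2 ^ 40) by (apply pow_lt; lra).
assert (h : IZR b * IZR y <= IZR a * 2 ^ Z.to_nat (40 - e)).
  rewrite pow_IZR, <- !mult_IZR, Z2Nat.id by lia.
  apply IZR_le; unfold y; apply Z.mul_div_le; lia.
apply ln_le in h; [|nra].
rewrite !ln_mult in h by (try apply pow_lt; lra).
rewrite ln_pow2, INR_IZR_INZ, Z2Nat.id, minus_IZR in h by lia.
unfold Rdiv; rewrite ln_mult, ln_Rinv, ln_pow2 by (try apply Rinv_0_lt_compat; lra).
replace (INR 40) with 40 by (simpl; ring); lra.
Qed.

(** An upper bound for a logarithm is obtained as a lower bound for the inverse quotient, hence the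
    negative constants [c] in its uses. *)
Lemma log2_lower_bound (j : nat) (c a b : Z) :
  (log2_valid a b && (c <=? log2_lower j a b)%Z)%bool = true ->
  IZR c * ln 2 <= 2 ^ j * (ln (IZR a) - ln (IZR b)).
Proof.
intros h; apply Bool.andb_true_iff in h; destruct h as [valid le_c].
apply Z.leb_le, IZR_le in le_c.
apply Rle_trans with (2 := log2_lower_correct j a b valid).
apply Rmult_le_compat_r; [|exact le_c].
assert (h := ln_lt_2); lra.
Qed.

Lemma ln_pow_IZR (a n : Z) : (0 < a)%Z -> (0 <= n)%Z -> ln (IZR (a ^ n)) = IZR n * ln (IZR a).
Proof.
intros a_gt0 n_ge0; rewrite <- (Z2Nat.id n) at 1 by exact n_ge0.
rewrite <- pow_IZR, ln_pow by (apply IZR_lt; exact a_gt0).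
now rewrite INR_IZR_INZ, Z2Nat.id by exact n_ge0.
Qed.

Lemma ln_mult_IZR (a b : Z) : (0 < a)%Z -> (0 < b)%Z ->
  ln (IZR (a * b)) = ln (IZR a) + ln (IZR b).
Proof. intros a_gt0 b_gt0; rewrite mult_IZR; apply ln_mult; apply IZR_lt; assumption. Qed.

(* Growth per unit of m of |s| * padeQ / 9 ^ M, by padeQ_upper with (a, c) = (8, 17). *)
Lemma padeQ_rate :
  23 * ln 25 + 53 * ln 208 + 30 * ln 16 - 30 * ln 81 - 23 * ln 17 - 13 * ln 8 - 40 * ln 200 <
  5971 / 1000 * ln 2.
Proof.
assert (h : _ <= _) by (apply (log2_lower_bound 17 (- 782581)
  (81 ^ 30 * 17 ^ 23 * 8 ^ 13 * 200 ^ 40) (25 ^ 23 * 208 ^ 53 * 16 ^ 30)); vm_compute; reflexivity).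
revert h; rewrite !ln_mult_IZR, !ln_pow_IZR by lia.
assert (h := ln_lt_2); replace (2 ^ 17) with 131072 by ring; lra.
Qed.

(* Growth per unit of m of padeR / 9 ^ M, by padeR_upper with (a, c) = (1, 18). *)
Lemma padeR_rate :
  53 * ln 27 - 30 * ln 9 - 23 * ln 18 - 13 * ln 19 < 578 / 100 * ln 2.
Proof.
assert (h : _ <= _) by (apply (log2_lower_bound 17 (- 757592)
  (9 ^ 30 * 18 ^ 23 * 19 ^ 13) (27 ^ 53)); vm_compute; reflexivity).
revert h; rewrite !ln_mult_IZR, !ln_pow_IZR by lia.
assert (h := ln_lt_2); replace (2 ^ 17) with 131072 by ring; lra.
Qed.

Lemma log2_four_thirds_upper : ln 4 - ln 3 <= 416 / 1000 * ln 2.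
Proof.
assert (h : _ <= _) by (apply (log2_lower_bound 17 (- 54400) 3 4); vm_compute; reflexivity).
assert (h2 := ln_lt_2); replace (2 ^ 17) with 131072 in h by ring; lra.
Qed.

(** [416 * r] pays for (4 / 3) ^ r and the 1000 is one bit, lost when a sum is bounded by twice its
    larger term. The next lemma is the analogue for R, where 4 ^ r costs [2000 * r]. *)
Lemma main_term_too_small (m r W Q S : R) : 0 < m -> 0 <= r ->
  (5971 * m + 416 * r + 1000) * ln 2 <= 1000 * W ->
  30 * m * ln 9 + W <= ln 2 + (S + Q) ->
  S + (60 * m + r) * ln 3 <= (60 * m + r) * ln 4 ->
  Q + (23 * m * ln 17 + 13 * m * ln 8 + 40 * m * ln 200) <= 23 * m * ln 25 + 53 * m * ln 208 ->
  False.
Proof.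
intros m_gt0 r_ge0 hW hle hS hQ.
assert (c1 := Rmult_lt_compat_l m _ _ m_gt0 padeQ_rate).
assert (c2 := Rmult_le_compat_l r _ _ r_ge0 log2_four_thirds_upper).
assert (e16 : ln 16 = 2 * ln 4) by (exact (ln_pow_IZR 4 2 eq_refl ltac:(lia))).
assert (e81 : ln 81 = 2 * ln 9) by (exact (ln_pow_IZR 9 2 eq_refl ltac:(lia))).
assert (e9 : ln 9 = 2 * ln 3) by (exact (ln_pow_IZR 3 2 eq_refl ltac:(lia))).
rewrite e16, e81, e9 in c1; rewrite e9 in hle; lra.
Qed.

Lemma remainder_too_small (m r W P : R) : 0 < m ->
  (5780 * m + 2000 * r + 1000) * ln 2 <= 1000 * W ->
  30 * m * ln 9 + W <= ln 2 + (r * ln 4 + P) ->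
  P + (23 * m * ln 18 + (13 * m + 1) * ln 19) <= 53 * m * ln 27 ->
  False.
Proof.
intros m_gt0 hW hle hP.
assert (c1 := Rmult_lt_compat_l m _ _ m_gt0 padeR_rate).
assert (e4 : ln 4 = 2 * ln 2) by (exact (ln_pow_IZR 2 2 eq_refl ltac:(lia))).
assert (h19 : 0 <= ln 19) by (rewrite <- ln_1; apply ln_le; lra).
rewrite e4 in hle; lra.
Qed.

(** The first bound holds since 416 * 119 + 1000 < 51000; in the second, 2000 * 119 + 1000 is also
    covered by the gap (5971 - 5780) m with m >= 2000. *)
Lemma content_margins (m r W : R) : r <= 119 -> 2000 <= m ->
  (5971 * m + 51000) * ln 2 <= 1000 * W ->
  (5971 * m + 416 * r + 1000) * ln 2 <= 1000 * W /\
  (5780 * m + 2000 * r + 1000) * ln 2 <= 1000 * W.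
Proof.
intros r_le m_ge hW; assert (h := ln_lt_2).
split; apply Rle_trans with (2 := hW); apply Rmult_le_compat_r; lra.
Qed.

End BinaryLogarithm.

(** * The Chebyshev certificate *)

Module Sweep.

Import List ListNotations.
Local Open Scope Z_scope.

(* A jump of a pair of integer step functions at a given time. *)
Definition event := (Z * (Z * Z))%type.
Definition add2 (x y : Z * Z) : Z * Z := (fst x + fst y, snd x + snd y).

Fixpoint total_upto (T : Z) (s : list event) : Z * Z :=
  match s with
  | [] => (0, 0)
  | (t, d) :: s' => if t <=? T then add2 d (total_upto T s') else total_upto T s'
  end.

Fixpoint merge_events (s1 : list event) : list event -> list event :=
  match s1 with
  | [] => fun s2 => s2
  | x1 :: s1' =>
    (fix merge_aux (s2 : list event) : list event :=
     match s2 with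
     | [] => s1
     | x2 :: s2' => if fst x1 <=? fst x2 then x1 :: merge_events s1' s2 else x2 :: merge_aux s2'
     end)
  end.

Fixpoint merge_pairs (l : list (list event)) : list (list event) :=
  match l with
  | a :: b :: l' => merge_events a b :: merge_pairs l'
  | _ => l
  end.

Definition merge_all (rounds : nat) (l : list (list event)) : list event :=
  fold_right merge_events [] (Nat.iter rounds merge_pairs l).

Fixpoint ticks (fuel : nat) (t P : Z) (d : Z * Z) : list event :=
  match fuel with
  | O => []
  | S fuel' => (t, d) :: ticks fuel' (t + P) P d
  end.

(** Jumps at equal times are added before [ok] is tested, so each constant piece is tested once. The
    test [last <? t] certifies the order of the events; of the merge, the correctness proof uses
    only the totals. *)
Fixpoint sweep (ok : Z * Z -> bool) (last : Z) (acc : Z * Z) (s : list event) : bool :=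
  match s with
  | [] => ok acc
  | (t, d) :: s' =>
    if t =? last then sweep ok last (add2 acc d) s'
    else (last <? t) && ok acc && sweep ok t (add2 acc d) s'
  end.

Lemma add2A x y z : add2 x (add2 y z) = add2 (add2 x y) z.
Proof. destruct x, y, z; unfold add2; simpl; f_equal; lia. Qed.

Lemma add2C x y : add2 x y = add2 y x.
Proof. destruct x, y; unfold add2; simpl; f_equal; lia. Qed.

Lemma add2_0l x : add2 (0, 0) x = x.
Proof. destruct x; reflexivity. Qed.

Lemma merge_events_cons x1 s1 x2 s2 : merge_events (x1 :: s1) (x2 :: s2) =
  if fst x1 <=? fst x2 then x1 :: merge_events s1 (x2 :: s2)
  else x2 :: merge_events (x1 :: s1) s2.
Proof. reflexivity. Qed.

Lemma total_cons T x s : total_upto T (x :: s) =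
  add2 (if fst x <=? T then snd x else (0, 0)) (total_upto T s).
Proof. destruct x as [t d]; simpl; destruct (t <=? T); now rewrite ?add2_0l. Qed.

Lemma total_merge T s1 s2 :
  total_upto T (merge_events s1 s2) = add2 (total_upto T s1) (total_upto T s2).
Proof.
revert s2; induction s1 as [|x1 s1 IH1]; intros s2; [now rewrite add2_0l|].
induction s2 as [|x2 s2 IH2]; [now rewrite add2C, add2_0l|].
rewrite merge_events_cons; destruct (fst x1 <=? fst x2).
  now rewrite !total_cons, IH1, total_cons, !add2A.
rewrite total_cons, IH2, !total_cons, !add2A; f_equal.
now rewrite (add2C (if fst x2 <=? T then _ else _)), <- !add2A, (add2C (total_upto T s1)).
Qed.

Lemma total_merge_all T rounds l :
  total_upto T (merge_all rounds l) = fold_right (fun s => add2 (total_upto T s)) (0, 0) l.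
Proof.
assert (pairs : forall l, fold_right (fun s => add2 (total_upto T s)) (0, 0) (merge_pairs l) =
    fold_right (fun s => add2 (total_upto T s)) (0, 0) l).
  fix IH 1; intros [|a [|b l']]; [reflexivity|reflexivity|].
  simpl; rewrite total_merge, IH, add2A; reflexivity.
unfold merge_all; transitivity
  (fold_right (fun s => add2 (total_upto T s)) (0, 0) (Nat.iter rounds merge_pairs l)).
  generalize (Nat.iter rounds merge_pairs l) as l'; induction l' as [|a l' IH]; [reflexivity|].
  simpl; now rewrite total_merge, IH.
induction rounds as [|r IH]; [reflexivity|]; simpl; now rewrite pairs.
Qed.

Lemma sweep_lower ok last acc s T : sweep ok last acc s = true -> T < last ->
  total_upto T s = (0, 0).
Proof.
revert last acc; induction s as [|[t d] s IH]; intros last acc; [reflexivity|].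
simpl; destruct (Z.eqb_spec t last) as [->|ne].
  intros h lt; destruct (Z.leb_spec last T); [lia|eauto].
rewrite !Bool.andb_true_iff, Z.ltb_lt; intros [[lt_t _] h] lt.
destruct (Z.leb_spec t T); [lia|]; eapply IH; [exact h|lia].
Qed.

Lemma sweep_correct ok last acc s T : sweep ok last acc s = true -> last <= T ->
  ok (add2 acc (total_upto T s)) = true.
Proof.
revert last acc; induction s as [|[t d] s IH]; intros last acc.
  intros h _; simpl; now rewrite add2C, add2_0l.
simpl; destruct (Z.eqb_spec t last) as [->|ne].
  intros h le; destruct (Z.leb_spec last T); [|lia].
  now rewrite add2A; apply (IH last).
rewrite !Bool.andb_true_iff, Z.ltb_lt; intros [[lt_t hok] h] le.
destruct (Z.leb_spec t T) as [le_t|lt_T].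
  now rewrite add2A; apply (IH t).
now rewrite (sweep_lower _ _ _ _ _ h lt_T), add2C, add2_0l.
Qed.

Lemma total_ticks fuel t P d T : 0 < P -> T < t + Z.of_nat fuel * P ->
  total_upto T (ticks fuel t P d) =
  (Z.max 0 ((T - t) / P + 1) * fst d, Z.max 0 ((T - t) / P + 1) * snd d).
Proof.
intros P_pos; revert t; induction fuel as [|fuel IH]; intros t lt_T.
  assert ((T - t) / P < 0) by (apply Z.div_lt_upper_bound; lia).
  simpl; now rewrite Z.max_l by lia.
simpl; rewrite IH by lia.
replace (T - (t + P)) with (T - t + (-1) * P) by ring; rewrite Z.div_add by lia.
destruct (Z.leb_spec t T) as [le|lt].
  assert (0 <= (T - t) / P) by (apply Z.div_pos; lia).
  unfold add2; simpl; rewrite !Z.max_r by lia; f_equal; ring.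
assert ((T - t) / P < 0) by (apply Z.div_lt_upper_bound; lia).
rewrite !Z.max_l by lia; reflexivity.
Qed.

Definition ticks_upto (Tmax P : Z) (d : Z * Z) : list event :=
  ticks (Z.to_nat ((Tmax - 1) / P)) P P d.

Lemma total_ticks_upto Tmax P d T : 0 < P -> 0 <= T < Tmax ->
  total_upto T (ticks_upto Tmax P d) = (T / P * fst d, T / P * snd d).
Proof.
intros P_pos range; unfold ticks_upto.
assert (fuel_pos : 0 <= (Tmax - 1) / P) by (apply Z.div_pos; lia).
assert (below : (T - P) / P + 1 = T / P).
  replace (T - P) with (T + (-1) * P) by ring; rewrite Z.div_add; lia.
rewrite total_ticks, below by (assumption ||
  (rewrite Z2Nat.id by assumption; pose proof (Z.mul_succ_div_gt (Tmax - 1) P P_pos); lia)).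
now rewrite Z.max_r by (apply Z.div_pos; lia).
Qed.

(* All the step functions below jump at multiples of 1 / time_unit only. *)
Definition time_unit : Z := 53 * 23 * 17 * 13.
(** With T = [y * time_unit], the floor [a y / b] is the quotient of T by this integer, since a
    divides [time_unit]. *)
Definition period (a b : Z) : Z := b * (time_unit / a).

(* A triple (a, b, e) stands for the term e * [a y / b] of the minorant of 60 times the indicator
   of [53 y] - [23 y] - [17 y] - [13 y] >= 2; the coefficients come from linear programming. *)
Definition factorials : list (Z * Z * Z) :=
  [(53,2,60); (23,1,-60); (53,3,60); (17,1,-60); (13,1,-60); (23,2,60); (53,6,-60);
   (23,3,60); (23,4,-60); (17,3,60); (53,10,-60); (53,11,60); (17,4,60); (23,6,-60);
   (53,14,-60); (13,4,60); (53,20,60); (53,21,-60); (53,22,-60); (23,11,19);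
   (53,26,-19); (13,7,60); (23,13,11); (53,30,49); (13,8,-60); (53,33,-60); (23,16,60);
   (17,12,-60); (53,38,-60); (13,10,42); (53,42,78); (53,43,30); (23,19,30);
   (17,15,-23); (23,21,-37); (13,12,-23); (17,16,-25); (23,22,-31); (53,52,19);
   (13,14,-60); (53,59,30); (53,60,-90); (53,61,42); (13,15,18); (23,27,-60);
   (53,65,34); (53,66,26); (23,29,37); (23,30,-37); (13,17,60); (53,70,60); (23,31,-19);
   (17,26,-43); (13,20,-39); (23,36,42); (13,21,-90); (23,38,-90); (17,29,60);
   (17,30,-37); (23,41,60); (23,42,25); (23,43,60); (23,44,14); (23,45,-11);
   (23,47,-19); (17,35,-15); (13,28,60); (13,30,-60); (13,31,10); (13,32,-5);
   (23,61,-40); (13,35,-60); (17,48,23); (13,37,23); (23,66,34); (13,41,38); (13,43,60);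
   (17,58,-41); (17,62,-27); (13,51,-22); (1,4,-79); (17,69,-30); (17,70,4);
   (13,56,41); (13,57,60); (13,59,60); (13,60,60); (13,63,16); (13,70,15)].

(** The minorant also contains [balance * [y]], whose coefficient is not an integer; the sweep
    replaces it by the upper bound 60. *)
Definition top_coefficient : Z := 60.

(* The minorant exceeds its target by at most the sum of the h over the pairs (t, h) with
   t <= y * time_unit. *)
Definition losses : list (Z * Z) :=
  [(416806,1); (1089309,25); (1621477,49); (2429674,41); (4757688,26); (6243029,29);
   (15172755,47); (38418640,48); (67349750,1706)].

(** The last loss, 1706, sits exactly at the horizon: from there on the losses exceed the sum of the
    absolute values of the negative coefficients, which suffices without any sweep. *)
Definition horizon : Z := 250 * time_unit.

Definition all_events : list (list event) :=
  map (fun x => ticks_upto horizon (period (fst (fst x)) (snd (fst x))) (snd x, 0))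
      ((1, 1, top_coefficient) :: factorials) ++
  map (fun x => ticks_upto horizon (period (fst x) 1) (0, snd x))
      [(53, 1); (23, -1); (17, -1); (13, -1)] ++
  map (fun x => [(fst x, (- snd x, 0))]) losses.

Definition admissible (acc : Z * Z) : bool := fst acc <=? (if 2 <=? snd acc then 60 else 0).

Definition certificate_ok : bool :=
  forallb (fun x => 0 <? period (fst (fst x)) (snd (fst x))) factorials &&
  sweep admissible 0 (0, 0) (merge_all 8 all_events).

Lemma certificate_holds : certificate_ok = true.
Proof. vm_cast_no_check (eq_refl true). Qed.

End Sweep.

(** * Enumeration of primes *)

Module PrimeWalk.

Import List ListNotations Sorted BinaryLogarithm.
Local Open Scope Z_scope.

Fixpoint strike (q c : nat) (l : list bool) : list bool :=
  match l with
  | [] => []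
  | b :: l' => match c with O => false :: strike q (q - 1) l' | S c' => b :: strike q c' l' end
  end.

Definition primes_below_231 : list nat :=
  [2; 3; 5; 7; 11; 13; 17; 19; 23; 29; 31; 37; 41; 43; 47; 53; 59; 61; 67; 71; 73; 79; 83; 89;
   97; 101; 103; 107; 109; 113; 127; 131; 137; 139; 149; 151; 157; 163; 167; 173; 179; 181; 191;
   193; 197; 199; 211; 223; 227; 229]%nat.

(* The flag of index i is about the number 231 + i. *)
Definition prime_flags (len : nat) : list bool :=
  fold_right (fun q => strike q ((q - 231 mod q) mod q)) (repeat true len) primes_below_231.

Definition log_weight (n : Z) : Z := if log2_valid n 1 then log2_lower 7 n 1 else 0.

(* Pairs a prime n with a lower bound of 128 * log2 n, recomputed only every time n has grown by
   a factor 65 / 64. *)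
Fixpoint weighted (n next a : Z) (flags : list bool) : list (Z * Z) :=
  match flags with
  | [] => []
  | b :: flags' =>
    if b then
      if n <? next then (n, a) :: weighted (n + 1) next a flags'
      else let a' := log_weight n in (n, a') :: weighted (n + 1) (n + n / 64) a' flags'
    else weighted (n + 1) next a flags'
  end.

Fixpoint take_upto (h : Z) (t : list (Z * Z)) : list (Z * Z) :=
  match t with
  | [] => []
  | x :: t' => if fst x <=? h then x :: take_upto h t' else []
  end.

Fixpoint drop_upto (h : Z) (t : list (Z * Z)) : list (Z * Z) :=
  match t with
  | [] => []
  | x :: t' => if fst x <=? h then drop_upto h t' else t
  end.

(* The primes x m / y < p <= 53 m / al, for which the quotients of 53 m, 23 m and 13 m by p are
   respectively al, be and ga, divide the content. *)
Definition windows : list ((Z * Z * Z) * (Z * Z)) :=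
  [((28, 12, 6), (17, 9)); ((27, 11, 6), (23, 12)); ((24, 10, 5), (13, 6)); ((23, 9, 5), (23, 10));
   ((20, 8, 4), (13, 5)); ((18, 7, 4), (23, 8)); ((16, 6, 3), (23, 7)); ((15, 6, 3), (17, 5));
   ((12, 5, 2), (13, 3)); ((11, 4, 2), (23, 5)); ((9, 3, 2), (23, 4)); ((8, 3, 1), (13, 2));
   ((6, 2, 1), (17, 2)); ((4, 1, 0), (13, 1)); ((3, 1, 0), (17, 1)); ((2, 0, 0), (23, 1))].

(** The windows are listed by increasing p, so one pass over the sorted table serves them all, and
    dropping what has been used keeps the primes distinct. *)
Fixpoint good_primes (m : Z) (ws : list ((Z * Z * Z) * (Z * Z))) (t : list (Z * Z)) :=
  match ws with
  | [] => []
  | ((al, _, _), (x, y)) :: ws' =>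
    let t' := drop_upto (x * m / y) t in
    let h := 53 * m / al in
    take_upto h t' ++ good_primes m ws' (drop_upto h t')
  end.

Definition total_weight (l : list (Z * Z)) : Z := fold_right (fun x => Z.add (snd x)) 0 l.

(* When the content exceeds 2 ^ (w / 128), the exponents 60 m + r with r <= reach m w are
   settled by m. *)
Definition reach (m w : Z) : Z :=
  Z.min ((1000 * w - 128 * (5780 * m + 1000)) / 256000)
        ((1000 * w - 128 * (5971 * m + 1000)) / 53248).

(* The step from m to the next one is even: the parity of m is imposed by the sign of s. *)
Fixpoint walk (fuel : nat) (t : list (Z * Z)) (m : Z) : bool :=
  match fuel with
  | O => false
  | S fuel' =>
    if 2001 <=? m then true else
    let r := reach m (total_weight (good_primes m windows t)) in
    if 119 <=? r then walk fuel' t (m + 2 * ((r + 1) / 120)) else false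
  end.

(** As 231 + 53130 = 231 ^ 2, striking the multiples of the primes below 231 leaves only primes. For
    127 <= m <= 2000 all windows lie between 17 * 127 / 9 > 231 and 53 * 2000 / 2 = 53000. *)
Definition prime_table : list (Z * Z) := weighted 231 0 0 (prime_flags (Z.to_nat 53130)).

Lemma walk_from_127 : walk 200 prime_table 127 = true.
Proof. vm_cast_no_check (eq_refl true). Qed.

Lemma walk_from_128 : walk 200 prime_table 128 = true.
Proof. vm_cast_no_check (eq_refl true). Qed.

(** From m the exponents 60 m, ..., 60 m + r are settled; the next value m' is the largest of the
    same parity with 60 m' <= 60 m + r + 1, so no exponent is skipped. *)
Lemma walk_covers (fuel : nat) (t : list (Z * Z)) : forall m k, walk fuel t m = true ->
  60 * m <= k < 120060 -> exists m' j r, m' = m + 2 * j /\ 0 <= j /\ k = 60 * m' + r /\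
    0 <= r <= reach m' (total_weight (good_primes m' windows t)).
Proof.
induction fuel as [|fuel IH]; intros m k; cbn [walk]; [discriminate|].
destruct (Z.leb_spec 2001 m); [lia|]; cbv zeta.
destruct (Z.leb_spec 119 (reach m (total_weight (good_primes m windows t)))) as [le_r|]; [|discriminate].
set (r := reach _ _) in *; intros hw hk.
destruct (Z.leb_spec (k - 60 * m) r) as [le_k|lt_k].
  exists m, 0, (k - 60 * m); lia.
assert (120 * ((r + 1) / 120) <= r + 1) by (apply Z.mul_div_le; lia).
assert (1 <= (r + 1) / 120) by (apply Z.div_le_lower_bound; lia).
destruct (IH _ k hw ltac:(lia)) as (m' & j & r' & -> & hj & hk' & hr).
exists (m + 2 * ((r + 1) / 120) + 2 * j), ((r + 1) / 120 + j), r'.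
repeat split; try tauto; lia.
Qed.

(** * Soundness of the sieve, the windows and the weights *)

Definition increasing : list (Z * Z) -> Prop := StronglySorted (fun x y => fst x < fst y).

Lemma take_upto_In h t x : In x (take_upto h t) -> In x t /\ fst x <= h.
Proof.
induction t as [|y t IH]; simpl; [tauto|].
destruct (Z.leb_spec (fst y) h); simpl; [|tauto].
intros [<-|x_in]; [auto|tauto].
Qed.

Lemma take_upto_NoDup h t : increasing t -> NoDup (map fst (take_upto h t)).
Proof.
induction 1 as [|y t inc IH lt_y]; simpl; [constructor|].
destruct (Z.leb_spec (fst y) h); simpl; [|constructor].
constructor; [|exact IH]; intros h_in; apply in_map_iff in h_in.
destruct h_in as (x & eq_x & x_in); apply take_upto_In in x_in.
rewrite Forall_forall in lt_y; specialize (lt_y x (proj1 x_in)); lia.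
Qed.

Lemma drop_upto_spec h t : increasing t ->
  increasing (drop_upto h t) /\ forall x, In x (drop_upto h t) -> In x t /\ h < fst x.
Proof.
induction 1 as [|y t inc IH lt_y]; simpl; [split; [constructor|tauto]|].
destruct (Z.leb_spec (fst y) h).
  destruct IH as [IH1 IH2]; split; [exact IH1|].
  intros x x_in; destruct (IH2 x x_in); tauto.
split; [constructor; assumption|].
rewrite Forall_forall in lt_y; intros x [<-|x_in]; [simpl; auto|].
specialize (lt_y x x_in); simpl; split; [auto|lia].
Qed.

Definition window_ok (w : (Z * Z * Z) * (Z * Z)) : bool :=
  let '((al, be, ga), (x, y)) := w in
  (0 <? al) && (0 <? y) && (0 <=? be) && (0 <=? ga) && (23 * y <=? (be + 1) * x) &&
  (13 * y <=? (ga + 1) * x) && (17 * y <=? (al - be - ga - 1) * x).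

Lemma windows_ok : forallb window_ok windows = true.
Proof. vm_compute; reflexivity. Qed.

Definition good_prime (m p : Z) : Prop :=
  p + (53 * m) mod p <= (23 * m) mod p + (13 * m) mod p.

(** In the window the quotient of 53 m by p is at least al, those of 23 m and 13 m are at most be
    and ga, and 17 m <= (al - be - ga - 1) p. Since 53 - 23 - 13 = 17, this is the inequality
    between the remainders. *)
Lemma window_good al be ga x y m p : window_ok ((al, be, ga), (x, y)) = true ->
  0 < m -> 0 < p -> x * m / y < p <= 53 * m / al -> good_prime m p.
Proof.
unfold window_ok; rewrite !andb_true_iff, !Z.ltb_lt, !Z.leb_le.
intros [[[[[[al_pos y_pos] be_pos] ga_pos] h23] h13] h17] m_pos p_pos [lo hi].
assert (hi' : al * p <= 53 * m).
  assert (al * (53 * m / al) <= 53 * m) by (apply Z.mul_div_le; lia); nia.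
assert (lo' : x * m < y * p).
  assert (x * m < y * (x * m / y + 1)) by (pose proof (Z.mul_succ_div_gt (x * m) y); lia); nia.
remember (al - be - ga - 1) as de.
assert (x_pos : 0 < x) by nia.
assert (b23 : 23 * m < (be + 1) * p).
  apply Z.mul_lt_mono_pos_l with (p := y); [exact y_pos|].
  apply Z.le_lt_trans with ((be + 1) * (x * m)); nia.
assert (b13 : 13 * m < (ga + 1) * p).
  apply Z.mul_lt_mono_pos_l with (p := y); [exact y_pos|].
  apply Z.le_lt_trans with ((ga + 1) * (x * m)); nia.
assert (de_pos : 0 < de) by nia.
assert (b17 : 17 * m <= de * p).
  apply Z.mul_le_mono_pos_l with (p := y); [exact y_pos|].
  assert (17 * y * m <= de * x * m) by (apply Z.mul_le_mono_nonneg_r; lia).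
  assert (de * (x * m) <= de * (y * p)) by (apply Z.mul_le_mono_nonneg_l; lia).
  lia.
assert (q53 : al <= 53 * m / p) by (apply Z.div_le_lower_bound; lia).
assert (q23 : 23 * m / p <= be) by (apply Z.lt_succ_r, Z.div_lt_upper_bound; lia).
assert (q13 : 13 * m / p <= ga) by (apply Z.lt_succ_r, Z.div_lt_upper_bound; lia).
unfold good_prime.
pose proof (Z.div_mod (53 * m) p ltac:(lia)); pose proof (Z.div_mod (23 * m) p ltac:(lia)).
pose proof (Z.div_mod (13 * m) p ltac:(lia)).
assert (p * al <= p * (53 * m / p)) by (apply Z.mul_le_mono_nonneg_l; lia).
assert (p * (23 * m / p) <= p * be) by (apply Z.mul_le_mono_nonneg_l; lia).
assert (p * (13 * m / p) <= p * ga) by (apply Z.mul_le_mono_nonneg_l; lia).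
subst de; lia.
Qed.

Lemma good_primes_spec m t : 0 < m -> increasing t -> (forall x, In x t -> 0 < fst x) ->
  NoDup (map fst (good_primes m windows t)) /\
  forall x, In x (good_primes m windows t) -> In x t /\ good_prime m (fst x).
Proof.
intros m_pos; pose proof windows_ok as ok; revert t ok; generalize windows as ws.
induction ws as [|[[[al be] ga] [x y]] ws IH]; intros t ok inc pos; [split; [constructor|simpl; tauto]|].
simpl forallb in ok; apply andb_true_iff in ok; destruct ok as [ok_w ok].
cbn [good_primes]; cbv zeta.
destruct (drop_upto_spec (x * m / y) t inc) as [inc' in'].
set (t' := drop_upto _ t) in *; set (h := 53 * m / al).
destruct (drop_upto_spec h t' inc') as [inc2 in2].
destruct (IH (drop_upto h t') ok inc2) as [nodup spec].
  intros z z_in; apply pos, in', in2, z_in.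
split.
- rewrite map_app; apply NoDup_app; [apply take_upto_NoDup, inc'|exact nodup|].
  intros a a_in a_in'; apply in_map_iff in a_in, a_in'.
  destruct a_in as (z & <- & z_in), a_in' as (z' & eq_z & z'_in).
  apply take_upto_In in z_in; apply spec in z'_in; destruct z'_in as [z'_in _].
  apply in2 in z'_in; lia.
- intros z z_in; apply in_app_or in z_in; destruct z_in as [z_in|z_in].
    apply take_upto_In in z_in; destruct z_in as [z_in le_z].
    apply in' in z_in; destruct z_in as [z_in lt_z]; split; [exact z_in|].
    apply window_good with (1 := ok_w); auto.
  apply spec in z_in; destruct z_in as [z_in good]; split; [apply in', in2, z_in|exact good].
Qed.

Lemma strike_nth q c l i : (0 < q)%nat -> nth i (strike q c l) false = true ->
  nth i l false = true /\ forall t, i <> (c + q * t)%nat.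
Proof.
intros q_pos; revert c i; induction l as [|b l IH]; intros c i; simpl; [destruct i; discriminate|].
destruct c as [|c], i as [|i]; simpl; try discriminate; intros h.
- apply IH in h; destruct h as [h ne]; split; [exact h|].
  intros [|t] e; [lia|]; apply (ne t); lia.
- split; [exact h|intros t; lia].
- apply IH in h; destruct h as [h ne]; split; [exact h|]; intros t e; apply (ne t); lia.
Qed.

Lemma strike_offset (a q i : nat) : (0 < q)%nat ->
  (forall t, i <> ((q - a mod q) mod q + q * t)%nat) -> ((a + i) mod q <> 0)%nat.
Proof.
intros q_pos ne e; apply (ne (i / q)%nat).
assert (e1 := Nat.div_mod_eq i q); assert (e2 := Nat.div_mod_eq a q).
assert (e3 := Nat.div_mod_eq (a + i) q); rewrite e in e3.
assert (b1 := Nat.mod_upper_bound i q ltac:(lia)).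
assert (b2 := Nat.mod_upper_bound a q ltac:(lia)).
set (u := (i mod q)%nat) in *; set (v := (a mod q)%nat) in *.
enough (u = (q - v) mod q)%nat by lia.
set (x := (i / q)%nat) in *; set (y := (a / q)%nat) in *; set (z := ((a + i) / q)%nat) in *.
assert (sum : (q * z = q * (x + y) + (u + v))%nat) by lia.
assert (z = x + y \/ z = x + y + 1)%nat by nia.
destruct (Nat.eq_dec v 0) as [v0|v0].
  rewrite v0, Nat.sub_0_r, Nat.Div0.mod_same; nia.
rewrite Nat.mod_small by lia; nia.
Qed.

Lemma prime_flags_nth len i : nth i (prime_flags len) false = true ->
  (i < len)%nat /\ forall q, In q primes_below_231 -> ((231 + i) mod q <> 0)%nat.
Proof.
unfold prime_flags; intros h.
assert (pos : forall q, In q primes_below_231 -> (0 < q)%nat).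
  apply Forall_forall; repeat constructor.
revert pos h; induction primes_below_231 as [|q qs IH]; cbn [fold_right In]; intros pos h.
- split; [|tauto]; destruct (Nat.lt_ge_cases i len) as [lt|ge]; [exact lt|].
  rewrite nth_overflow in h; [discriminate|]; rewrite repeat_length; exact ge.
- apply strike_nth in h; [|apply pos; auto]; destruct h as [h ne].
  destruct (IH (fun q q_in => pos q (or_intror q_in)) h) as [lt all].
  split; [exact lt|]; intros q' [<-|q_in]; [|apply all; exact q_in].
  apply (strike_offset 231 q i); [apply pos; auto|exact ne].
Qed.

Definition weight_valid (x : Z * Z) : Prop := (IZR (snd x) * ln 2 <= 128 * ln (IZR (fst x)))%R.

Lemma log_weight_valid n : 0 < n -> weight_valid (n, log_weight n).
Proof.
intros n_pos; unfold weight_valid, log_weight; simpl fst; simpl snd.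
destruct (log2_valid n 1) eqn:valid.
  assert (h := log2_lower_correct 7 n 1 valid); rewrite ln_1 in h.
  replace (2 ^ 7)%R with 128%R in h by ring; lra.
assert (0 <= ln (IZR n))%R; [|lra].
rewrite <- ln_1; apply ln_le; [lra|apply IZR_le; lia].
Qed.

Lemma weighted_spec flags : forall n next a, 0 < n -> weight_valid (n, a) ->
  increasing (weighted n next a flags) /\
  forall x, In x (weighted n next a flags) -> weight_valid x /\
    exists i : nat, fst x = n + Z.of_nat i /\ nth i flags false = true.
Proof.
assert (step : forall n a, 0 < n -> weight_valid (n, a) -> weight_valid (n + 1, a)).
  unfold weight_valid; simpl; intros n a n_pos valid.
  assert (ln (IZR n) <= ln (IZR (n + 1)))%R; [|lra].
  apply ln_le; [apply IZR_lt; lia|apply IZR_le; lia].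
induction flags as [|b flags IH]; intros n next a n_pos valid; [split; [constructor|simpl; tauto]|].
assert (cons_spec : forall next' a', weight_valid (n, a') ->
    increasing ((n, a') :: weighted (n + 1) next' a' flags) /\
    forall x, In x ((n, a') :: weighted (n + 1) next' a' flags) -> weight_valid x /\
      exists i : nat, fst x = n + Z.of_nat i /\ nth i (true :: flags) false = true).
  intros next' a' valid'.
  destruct (IH (n + 1) next' a' ltac:(lia) (step _ _ n_pos valid')) as [inc spec]; split.
    constructor; [exact inc|]; apply Forall_forall; intros x x_in.
    destruct (spec x x_in) as [_ (i & e & _)]; simpl; lia.
  intros x [<-|x_in]; [split; [exact valid'|exists O; simpl; split; [lia|reflexivity]]|].
  destruct (spec x x_in) as [v (i & e & fl)]; split; [exact v|exists (S i); split; [lia|exact fl]].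
cbn [weighted]; destruct b.
  destruct (n <? next); apply cons_spec; [exact valid|apply log_weight_valid, n_pos].
destruct (IH (n + 1) next a ltac:(lia) (step _ _ n_pos valid)) as [inc spec]; split; [exact inc|].
intros x x_in; destruct (spec x x_in) as [v (i & e & fl)]; split; [exact v|].
exists (S i); split; [lia|exact fl].
Qed.

Lemma prime_table_spec : increasing prime_table /\ forall x, In x prime_table -> weight_valid x /\
  exists i : nat, fst x = 231 + Z.of_nat i /\ Z.of_nat i < 53130 /\
    forall q, In q primes_below_231 -> ((231 + i) mod q <> 0)%nat.
Proof.
unfold prime_table; destruct (weighted_spec (prime_flags (Z.to_nat 53130)) 231 0 0) as [inc spec].
- lia.
- unfold weight_valid; simpl; rewrite Rmult_0_l; apply Rmult_le_pos; [lra|].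
  rewrite <- ln_1; apply ln_le; lra.
- split; [exact inc|]; intros x x_in; destruct (spec x x_in) as [v (i & e & fl)].
  split; [exact v|exists i]; apply prime_flags_nth in fl; destruct fl as [lt all].
  split; [exact e|split; [lia|exact all]].
Qed.

Lemma total_weight_le l : (forall x, In x l -> weight_valid x) ->
  (IZR (total_weight l) * ln 2 <= 128 * fold_right (fun x => Rplus (ln (IZR (fst x)))) 0 l)%R.
Proof.
induction l as [|x l IH]; intros valid; simpl; [lra|].
assert (hx : weight_valid x) by (apply valid; left; reflexivity); unfold weight_valid in hx.
assert (hl := IH (fun y y_in => valid y (or_intror y_in))); rewrite plus_IZR; lra.
Qed.

(** 256000 = 128 * 2000 and 53248 = 128 * 416: [reach] solves the two inequalities for r, with
    logarithms counted in units of 1 / 128 bit. *)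
Lemma reach_bounds m w r (L : R) : r <= reach m w -> (IZR w * ln 2 <= 128 * L)%R ->
  ((5971 * IZR m + 416 * IZR r + 1000) * ln 2 <= 1000 * L /\
   (5780 * IZR m + 2000 * IZR r + 1000) * ln 2 <= 1000 * L)%R.
Proof.
unfold reach; intros le_r hL.
assert (hR : 256000 * r <= 1000 * w - 128 * (5780 * m + 1000)).
  pose proof (Z.mul_div_le (1000 * w - 128 * (5780 * m + 1000)) 256000); lia.
assert (hQ : 53248 * r <= 1000 * w - 128 * (5971 * m + 1000)).
  pose proof (Z.mul_div_le (1000 * w - 128 * (5971 * m + 1000)) 53248); lia.
apply IZR_le in hQ, hR.
rewrite !minus_IZR, !mult_IZR, plus_IZR, mult_IZR in hQ, hR.
assert (h2 : (0 <= ln 2)%R) by (assert (h := ln_lt_2); lra).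
apply (Rmult_le_compat_r _ _ _ h2) in hQ, hR; lra.
Qed.

End PrimeWalk.

(** * Small exponents *)

Module FarPowers.

Import List ListNotations.
Local Open Scope Z_scope.

Inductive digit := D0 | D1 | D2 | D3.

Definition digit_value (d : digit) : Z := match d with D0 => 0 | D1 => 1 | D2 => 2 | D3 => 3 end.

Fixpoint value (l : list digit) : Z :=
  match l with
  | [] => 0
  | d :: l' => digit_value d * 4 ^ Z.of_nat (length l') + value l'
  end.

(* Division by 3 of base 4 numerals, most significant digit first, as an automaton whose state is
   the running remainder. *)
Fixpoint div3 (r : digit) (l : list digit) : list digit :=
  match l with
  | [] => []
  | d :: l' =>
    match r, d with
    | D0, D0 => D0 :: div3 D0 l' | D0, D1 => D0 :: div3 D1 l'
    | D0, D2 => D0 :: div3 D2 l' | D0, D3 => D1 :: div3 D0 l'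
    | D1, D0 => D1 :: div3 D1 l' | D1, D1 => D1 :: div3 D2 l'
    | D1, D2 => D2 :: div3 D0 l' | D1, D3 => D2 :: div3 D1 l'
    | _, D0 => D2 :: div3 D2 l' | _, D1 => D3 :: div3 D0 l'
    | _, D2 => D3 :: div3 D1 l' | _, D3 => D3 :: div3 D2 l'
    end
  end.

(** Division by 3 shortens a base 4 numeral by at most one digit, so one trim per division keeps the
    length a sharp measure of the size. *)
Definition trim (l : list digit) : list digit := match l with D0 :: l' => l' | _ => l end.

Definition quotient (k n : nat) : list digit :=
  Nat.iter k (fun l => trim (div3 D0 l)) (D1 :: repeat D0 n).

(* Eight base 4 digits of the fractional part of [4 ^ k0 / 3 ^ k1] show that it is farther than
   [4 ^ k0 / 9 ^ k1] from an integer; the size of [3 ^ k1] is read off the length of the quotient. *)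
Definition far_from_integer (k1 k0 : nat) : bool :=
  let y := quotient k1 (k0 + 8) in
  let n := length y in
  let w := value (skipn (n - 8) y) in
  let e := 2 * Z.of_nat n - Z.of_nat k0 - 8 in
  (8 <=? Z.of_nat n) && (0 <=? e) && (4 ^ e <=? w) && (4 ^ e <=? 65535 - w).

Fixpoint far_ranges (top : Z) (cuts : list Z) : bool :=
  match cuts with
  | [] => top =? 5
  | k1 :: cuts' =>
    (0 <=? k1) && far_from_integer (Z.to_nat k1) (Z.to_nat top) && far_ranges (k1 - 1) cuts'
  end.

(** Each cut serves the exponents from itself up to just below the previous cut. The test can
    succeed only if 4 ^ k0 / 9 ^ k1 is below 1/2, which limits the ratio k0 / k1 to ln 9 / ln 4. *)
Definition cuts : list Z :=
  [4847; 3059; 1931; 1219; 770; 489; 310; 196; 124; 80; 51; 33; 22; 14; 9; 8; 6].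

Lemma far_ranges_hold : far_ranges 7679 cuts = true.
Proof. vm_cast_no_check (eq_refl true). Qed.

Lemma div3_spec l : forall r, digit_value r < 3 -> length (div3 r l) = length l /\
  exists s, 0 <= s < 3 /\ digit_value r * 4 ^ Z.of_nat (length l) + value l = 3 * value (div3 r l) + s.
Proof.
induction l as [|d l IH]; intros r r_lt.
  split; [reflexivity|exists (digit_value r)]; destruct r; simpl in *; lia.
assert (e : 4 ^ Z.of_nat (length (d :: l)) = 4 * 4 ^ Z.of_nat (length l)).
  cbn [length]; rewrite Nat2Z.inj_succ, Z.pow_succ_r; lia.
assert (step : forall q r', digit_value r' < 3 ->
    4 * digit_value r + digit_value d = 3 * digit_value q + digit_value r' ->
    length (q :: div3 r' l) = length (d :: l) /\ exists s, 0 <= s < 3 /\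
      digit_value r * 4 ^ Z.of_nat (length (d :: l)) + value (d :: l) = 3 * value (q :: div3 r' l) + s).
  intros q r' r'_lt eq_d; destruct (IH r' r'_lt) as [len (s & hs & eq_v)].
  split; [cbn [length]; lia|exists s; split; [exact hs|]].
  rewrite e; cbn [value]; rewrite len.
  replace (digit_value d) with (3 * digit_value q + digit_value r' - 4 * digit_value r) by lia.
  lia.
destruct r, d; cbn [div3]; try (apply step; simpl; lia); simpl in r_lt; lia.
Qed.

Lemma value_bounds l : 0 <= value l < 4 ^ Z.of_nat (length l).
Proof.
induction l as [|d l IH]; [simpl; lia|].
cbn [length value]; rewrite Nat2Z.inj_succ, Z.pow_succ_r by lia.
destruct d; cbn [digit_value]; lia.
Qed.

Lemma value_trim l : value (trim l) = value l.
Proof. destruct l as [|[] l]; simpl; lia. Qed.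

Lemma value_app l1 l2 : value (l1 ++ l2) = value l1 * 4 ^ Z.of_nat (length l2) + value l2.
Proof.
induction l1 as [|d l1 IH]; [simpl; lia|].
cbn [value app]; rewrite IH, length_app, Nat2Z.inj_add, Z.pow_add_r by lia; ring.
Qed.

Lemma value_quotient k n : value (quotient k n) = 4 ^ Z.of_nat n / 3 ^ Z.of_nat k.
Proof.
unfold quotient; induction k as [|k IH].
  change (value (D1 :: repeat D0 n) = 4 ^ Z.of_nat n / 1).
  cbn [value]; rewrite repeat_length, Z.div_1_r.
  assert (value (repeat D0 n) = 0); [induction n; simpl; auto|cbn [digit_value]; lia].
rewrite Nat2Z.inj_succ, Z.pow_succ_r by lia.
rewrite (Z.mul_comm 3), <- Z.div_div, <- IH by (try apply Z.pow_pos_nonneg; lia).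
set (l := Nat.iter k _ _); change (Nat.iter (S k) _ _) with (trim (div3 D0 l)).
rewrite value_trim; destruct (div3_spec l D0 ltac:(simpl; lia)) as [_ (s & hs & e)].
cbn [digit_value] in e; apply Z.div_unique with (r := s); lia.
Qed.

Lemma far_from_integer_residue (k1 k0 : nat) : far_from_integer k1 k0 = true ->
  let M := 3 ^ Z.of_nat k1 in let A := 4 ^ Z.of_nat k0 in
  exists c r, A = M * c + r /\ 0 <= r < M /\ A < M * r /\ A < M * (M - r).
Proof.
unfold far_from_integer; rewrite !andb_true_iff, !Z.leb_le; cbv zeta.
set (y := quotient k1 (k0 + 8)); set (w := value _); set (e := 2 * Z.of_nat (length y) - _ - 8).
intros [[[n_ge e_ge] le_w] w_le]; set (M := 3 ^ Z.of_nat k1); set (A := 4 ^ Z.of_nat k0).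
assert (M_pos : 0 < M) by (apply Z.pow_pos_nonneg; lia).
assert (A_pos : 0 < A) by (apply Z.pow_pos_nonneg; lia).
assert (val_y : value y = A * 65536 / M).
  unfold y; rewrite value_quotient, Nat2Z.inj_add, Z.pow_add_r by lia; reflexivity.
assert (split_y : value y = value (firstn (length y - 8) y) * 65536 + w).
  rewrite <- (firstn_skipn (length y - 8) y) at 1.
  rewrite value_app, length_skipn; replace (Z.of_nat _) with 8 by lia; reflexivity.
set (c := value (firstn _ _)) in split_y.
assert (eq_A := Z.div_mod (A * 65536) M ltac:(lia)).
assert (rho := Z.mod_pos_bound (A * 65536) M M_pos).
rewrite <- val_y, split_y in eq_A.
set (s := (A * 65536) mod M) in *.
set (r := A - M * c).
assert (eq_r : 65536 * r = M * w + s) by (unfold r; lia).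
assert (size : A * 65536 < M * 4 ^ Z.of_nat (length y)).
  apply Z.lt_le_trans with (M * (value y + 1)).
    rewrite val_y; apply Z.mul_succ_div_gt; lia.
  apply Z.mul_le_mono_nonneg_l; [lia|]; assert (h := value_bounds y); lia.
(* Squaring [size] and dividing by 4 ^ 8 A, as 2 n = e + k0 + 8: thus 4 ^ e exceeds 4 ^ 8 times the
   critical distance A / M ^ 2. *)
assert (size2 : A * 65536 < M * M * 4 ^ e).
  assert (pow_e : 4 ^ Z.of_nat (length y) * 4 ^ Z.of_nat (length y) = 4 ^ e * (A * 65536)).
    unfold A; change 65536 with (4 ^ 8); rewrite <- !Z.pow_add_r by lia.
    f_equal; unfold e; lia.
  apply Z.mul_lt_mono_pos_r with (A * 65536); [lia|].
  replace (M * M * 4 ^ e * (A * 65536)) with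
    (M * 4 ^ Z.of_nat (length y) * (M * 4 ^ Z.of_nat (length y))).
    apply Z.mul_lt_mono_nonneg; lia.
  replace (M * M * 4 ^ e * (A * 65536)) with (M * M * (4 ^ e * (A * 65536))) by ring.
  rewrite <- pow_e; ring.
assert (g1 : M * 4 ^ e <= 65536 * r).
  rewrite eq_r; apply Z.le_trans with (M * w); [|lia]; apply Z.mul_le_mono_nonneg_l; lia.
(* [w] truncates 65536 r / M, so the distance to the next integer is measured from w + 1; hence
   65535. *)
assert (g2 : M * 4 ^ e <= 65536 * (M - r)).
  replace (65536 * (M - r)) with (M * (65535 - w) + (M - s)) by lia.
  apply Z.le_trans with (M * (65535 - w)); [apply Z.mul_le_mono_nonneg_l|]; lia.
assert (p_pos : 0 < 4 ^ e) by (apply Z.pow_pos_nonneg; lia).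
assert (Mp_pos : 0 < M * 4 ^ e) by (apply Z.mul_pos_pos; assumption).
assert (h1 := Z.mul_le_mono_nonneg_l _ _ M ltac:(lia) g1).
assert (h2 := Z.mul_le_mono_nonneg_l _ _ M ltac:(lia) g2).
exists c, r; repeat split; try (unfold r; lia); try lia.
Qed.

(** Multiplying the approximation at k by 4 ^ (k0 - k) gives one of 4 ^ k0 by a multiple of 3 ^ k,
    hence of 3 ^ k1; the error u keeps |u| * 3 ^ k1 <= 4 ^ k0 because k1 <= k. *)
Lemma far_range_excludes (k1 k0 : nat) k X s : far_from_integer k1 k0 = true ->
  Z.of_nat k1 <= k <= Z.of_nat k0 -> 4 ^ k = 3 ^ k * X + s -> Z.abs s * 3 ^ k <= 4 ^ k -> False.
Proof.
intros far hk approx small.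
destruct (far_from_integer_residue k1 k0 far) as (c & r & eq_A & r_bounds & g1 & g2).
set (M := 3 ^ Z.of_nat k1) in *; set (A := 4 ^ Z.of_nat k0) in *.
set (u := 4 ^ (Z.of_nat k0 - k) * s).
assert (pow_split : A = 4 ^ (Z.of_nat k0 - k) * 4 ^ k).
  unfold A; rewrite <- Z.pow_add_r by lia; f_equal; lia.
assert (M_split : 3 ^ k = M * 3 ^ (k - Z.of_nat k1)).
  unfold M; rewrite <- Z.pow_add_r by lia; f_equal; lia.
assert (c_pos : 0 < 4 ^ (Z.of_nat k0 - k)) by (apply Z.pow_pos_nonneg; lia).
assert (d_pos : 0 < 3 ^ (k - Z.of_nat k1)) by (apply Z.pow_pos_nonneg; lia).
assert (u_small : Z.abs u * M <= A).
  apply Z.le_trans with (Z.abs u * 3 ^ k).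
    apply Z.mul_le_mono_nonneg_l; [lia|rewrite M_split].
    rewrite <- (Z.mul_1_r M) at 1; apply Z.mul_le_mono_nonneg_l; lia.
  unfold u; rewrite Z.abs_mul, (Z.abs_eq (4 ^ _)), pow_split, <- Z.mul_assoc by lia.
  apply Z.mul_le_mono_nonneg_l; lia.
set (t := c - 4 ^ (Z.of_nat k0 - k) * (3 ^ (k - Z.of_nat k1) * X)).
assert (e : u = r + M * t).
  unfold u; replace s with (4 ^ k - 3 ^ k * X) by lia.
  rewrite Z.mul_sub_distr_l, <- pow_split, eq_A, M_split; unfold t; ring.
destruct (Z.le_gt_cases 0 t) as [t_ge|t_lt].
  assert (0 <= M * t) by (apply Z.mul_nonneg_nonneg; lia).
  assert (r * M <= Z.abs u * M) by (apply Z.mul_le_mono_nonneg_r; lia); lia.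
assert (M * t <= M * -1) by (apply Z.mul_le_mono_nonneg_l; lia).
assert ((M - r) * M <= Z.abs u * M) by (apply Z.mul_le_mono_nonneg_r; lia); lia.
Qed.

Lemma far_ranges_exclude l : forall top k X s, far_ranges top l = true -> 6 <= k <= top ->
  4 ^ k = 3 ^ k * X + s -> Z.abs s * 3 ^ k <= 4 ^ k -> False.
Proof.
induction l as [|k1 l IH]; intros top k X s; cbn [far_ranges].
  rewrite Z.eqb_eq; lia.
rewrite !andb_true_iff, Z.leb_le; intros [[k1_ge far] rest] hk approx small.
destruct (Z.le_gt_cases k1 k).
  apply (far_range_excludes _ _ k X s far); [lia|exact approx|exact small].
apply (IH (k1 - 1) k X s rest); [lia|exact approx|exact small].
Qed.

End FarPowers.

(** * Common divisors of the Pade approximants *)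

Module Approximation.

Import all_boot all_order all_algebra reals Rstruct zify ring lra.
Import Order.TTheory GRing.Theory Num.Theory.
Delimit Scope Z_scope with ZZ.
Delimit Scope R_scope with RR.

Lemma sum_divn_widen p n K : (n < K)%N -> (1 < p)%N ->
  (\sum_(1 <= k < n.+1) n %/ p ^ k = \sum_(1 <= k < K) n %/ p ^ k)%N.
Proof.
move=> lt_nK p_gt1; rewrite [RHS](big_cat_nat (n := n.+1)) //=.
rewrite -[LHS]addn0; congr addn; rewrite big_nat_cond big1 // => k /andP[/andP[lt_nk _] _].
by apply: divn_small; apply: leq_trans lt_nk (ltnW (ltn_expl _ p_gt1)).
Qed.

(** Kummer's theorem: the valuation counts the carries in adding a and b in base p. *)
Lemma logn_bin p a b K : prime p -> (a + b < K)%N ->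
  logn p 'C(a + b, a) = (\sum_(1 <= k < K) (p ^ k <= a %% p ^ k + b %% p ^ k))%N.
Proof.
move=> p_pr lt_K; have p_gt1 := prime_gt1 p_pr.
have /bin_fact/(congr1 (logn p)) := leq_addr b a.
rewrite addKn !lognM ?muln_gt0 ?fact_gt0 ?bin_gt0 ?leq_addr // !logn_fact //.
rewrite !(sum_divn_widen p _ K) //; try lia.
have -> : (\sum_(1 <= k < K) (a + b) %/ p ^ k =
    \sum_(1 <= k < K) a %/ p ^ k + \sum_(1 <= k < K) b %/ p ^ k +
    \sum_(1 <= k < K) (p ^ k <= a %% p ^ k + b %% p ^ k))%N.
  rewrite -!big_split /=; apply: eq_bigr => k _.
  by rewrite divnD // expn_gt0 (ltnW p_gt1).
by move: (\sum_(1 <= k < K) _)%N => u; lia.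
Qed.

(* Both binomials below have at least one carry in base q: otherwise the digit of i
   is at most [N %% q] and also larger than [l %% q + n %% q - q]. *)
Definition content_at (l n N q : nat) : bool := (q + N %% q <= l %% q + n %% q)%N.

Lemma content_carry l n N q i : (0 < q)%N -> (i <= n <= N)%N -> content_at l n N q ->
  ((q <= i %% q + (N - i) %% q) || (q <= l %% q + (n - i) %% q))%N.
Proof.
move=> q_gt0 /andP[le_in le_nN]; rewrite /content_at => good.
rewrite -!implyNb; apply/implyP; rewrite -ltnNge => lt_q.
have := divn_eq i q; have := divn_eq n q; have := divn_eq N q; have := divn_eq (n - i) q.
have := divn_eq (N - i) q.
have := ltn_pmod i q_gt0; have := ltn_pmod n q_gt0; have := ltn_pmod N q_gt0.
have := ltn_pmod (n - i) q_gt0; have := ltn_pmod (N - i) q_gt0; have := ltn_pmod l q_gt0.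
have eN : (N %% q = i %% q + (N - i) %% q)%N.
  by rewrite -{1}(subnKC (leq_trans le_in le_nN)) modnD // leqNgt lt_q subn0.
have : ((n %% q = i %% q + (n - i) %% q) \/ (n %% q + q = i %% q + (n - i) %% q))%N.
  rewrite -{1 3}(subnKC le_in) modnD //.
  by case: leqP => h; [right; rewrite mul1n subnK|left; rewrite mul0n subn0].
by move: good; rewrite eN; lia.
Qed.

(** This is W. A prime power p ^ k satisfying [content_at] contributes one factor p, matched by a
    carry at position k in one of the two binomials of each term of P and Q. *)
Definition content (l n N K : nat) : nat :=
  \prod_(p < K | prime p) p ^ (\sum_(1 <= k < K) content_at l n N (p ^ k)).

Lemma prod_prime_powers_dvdn K (e : nat -> nat) a :
  (forall p, prime p -> (p < K)%N -> (p ^ e p %| a)%N) ->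
  (\prod_(p < K | prime p) p ^ e p %| a)%N.
Proof.
elim: K => [|K IH] dvda; first by rewrite big_ord0 dvd1n.
rewrite big_mkcond big_ord_recr -big_mkcond /=.
have {}IH : (\prod_(p < K | prime p) p ^ e p %| a)%N.
  by apply: IH => p p_pr lt_pK; apply: dvda => //; apply: ltnW.
case: ifP => [K_pr|_]; last by rewrite muln1.
rewrite Gauss_dvd ?IH ?dvda //.
apply: (big_ind (fun x => coprime x (K ^ e K))) => [|x y hx hy|p p_pr].
- exact: coprime1n.
- by rewrite coprimeMl hx hy.
- rewrite coprimeXl // coprimeXr // prime_coprime // dvdn_prime2 //.
  by rewrite neq_ltn ltn_ord.
Qed.

Lemma content_dvdn l n N K i : (i <= n <= N)%N -> (l + n <= N)%N -> (N < K)%N ->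
  (content l n N K %| 'C(N, i) * 'C(l + n - i, l))%N.
Proof.
move=> /andP[le_in le_nN] le_lnN lt_NK.
have le_iN := leq_trans le_in le_nN.
apply: (prod_prime_powers_dvdn K (fun p => \sum_(1 <= k < K) content_at l n N (p ^ k))%N).
move=> p p_pr _.
have bin_pos : (0 < 'C(N, i) * 'C(l + n - i, l))%N.
  by rewrite muln_gt0 !bin_gt0; lia.
rewrite pfactor_dvdn // lognM; last 2 first.
- by rewrite bin_gt0.
- by rewrite bin_gt0; lia.
rewrite -{2}(subnKC le_iN) -addnBA // !(logn_bin p _ _ K) //; try lia.
rewrite -big_split /=; apply: leq_sum => k _.
case Hc: (content_at l n N (p ^ k)) => //.
have := content_carry l n N (p ^ k) i.
rewrite expn_gt0 prime_gt0 // le_in le_nN Hc => /(_ isT isT isT).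
by case: (_ <= _)%N => // /= ->; rewrite addn1.
Qed.

(** Exchanging l and n passes from the coefficients of Q to those of P. *)
Lemma content_sym l n N K : content l n N K = content n l N K.
Proof.
apply: eq_bigr => p _; congr (_ ^ _)%N; apply: eq_bigr => k _.
by rewrite /content_at addnC [(l %% _ + _)%N]addnC addnC.
Qed.

Local Open Scope ring_scope.

(** ** Pade approximants *)

(** Both sides are the coefficient of x ^ l in (1 - x) ^ i * (1 - x) ^ (- n - 1), and the sign of
    the exponent i - n - 1 separates the two cases. *)
Lemma binomial_alternating_sum (n i l : nat) :
  \sum_(j < l.+1) (-1) ^+ j * 'C(i, j)%:Z * 'C(l + n - j, n)%:Z =
  if (i <= n)%N then 'C(l + n - i, l)%:Z else (-1) ^+ l * 'C(i - n.+1, l)%:Z.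
Proof.
elim: i l => [|i IH] l.
  rewrite big_ord_recl big1 => [|j _]; last by rewrite bin0n /= mulr0 mul0r.
  rewrite expr0 bin0 !mul1r addr0 !subn0 leq0n.
  by rewrite addnC -[in RHS]bin_sub ?leq_addl // addnK.
case: l => [|l].
  rewrite big_ord_recl big_ord0 expr0 !bin0 !mul1r add0n subn0 binn addr0.
  by case: ifP.
have -> : \sum_(j < l.+2) (-1) ^+ j * 'C(i.+1, j)%:Z * 'C(l.+1 + n - j, n)%:Z =
   \sum_(j < l.+2) (-1) ^+ j * 'C(i, j)%:Z * 'C(l.+1 + n - j, n)%:Z -
   \sum_(j < l.+1) (-1) ^+ j * 'C(i, j)%:Z * 'C(l + n - j, n)%:Z.
  rewrite big_ord_recl [in RHS]big_ord_recl !bin0 /= -addrA; congr (_ + _).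
  rewrite -sumrB; apply: eq_bigr => j _.
  rewrite /bump /= add1n binS exprS PoszD addSn subSS; ring.
rewrite !IH.
have [lt_in|le_ni] := ltnP i n.
  rewrite (ltnW lt_in) addSn subSn; last by lia.
  by rewrite binS PoszD addrK.
case: (ltngtP i n) le_ni => // [lt_ni|->] _.
  by rewrite (subSn lt_ni) binS PoszD exprS; ring.
by rewrite subnn !addnK !binn subrr bin0n mulr0.
Qed.

Lemma bin_trinomial N i j : (j <= i <= N)%N ->
  ('C(N, i) * 'C(i, j) = 'C(N, j) * 'C(N - j, i - j))%N.
Proof.
move=> /andP[le_ji le_iN]; have le_jN := leq_trans le_ji le_iN.
have pos : (0 < j`! * (i - j)`! * (N - i)`!)%N by rewrite !muln_gt0 !fact_gt0.
apply/eqP; rewrite -(eqn_pmul2r pos); apply/eqP.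
have eN := bin_fact le_iN; have ei := bin_fact le_ji; have eNj := bin_fact le_jN.
have /bin_fact ed : (i - j <= N - j)%N by lia.
rewrite (_ : N - j - (i - j) = N - i)%N in ed; last by lia.
transitivity N`!.
  by rewrite -eN -ei; ring.
by rewrite -eNj -ed; ring.
Qed.

Lemma bin_expansion x N j : (j <= N)%N ->
  (\sum_(i < N.+1) 'C(N, i) * 'C(i, j) * x ^ (N - i) = 'C(N, j) * x.+1 ^ (N - j))%N.
Proof.
move=> le_jN; rewrite -(big_mkord xpredT (fun i => 'C(N, i) * 'C(i, j) * x ^ (N - i)))%N.
rewrite (big_cat_nat (n := j)) //=; last by lia.
rewrite big_nat_cond big1 ?add0n => [|i /andP[/andP[_ lt_ij] _]]; last first.
  by rewrite (bin_small lt_ij) muln0.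
rewrite -{1}[j]add0n big_addn subSn // -[x.+1]addn1 expnDn big_mkord big_distrr /=.
apply: eq_bigr => i _; have le_i := ltn_ord i.
rewrite exp1n muln1 bin_trinomial ?addnK; last by lia.
by rewrite mulnA subnDA [(N - _ - _)%N]subnAC.
Qed.

(** Write 9 = 8 + 1 in each 9 ^ (N - j) and exchange the sums. The terms with n < i <= n + l vanish,
    which is the order of contact of the Pade approximation. *)
Lemma pade_identity (l n N : nat) : (l <= N)%N ->
  \sum_(j < l.+1) (-1) ^+ j * ('C(l + n - j, n) * 'C(N, j) * 9 ^ (N - j))%:Z =
  \sum_(i < N.+1) ('C(N, i) * 8 ^ (N - i))%:Z *
     (if (i <= n)%N then 'C(l + n - i, l)%:Z else (-1) ^+ l * 'C(i - n.+1, l)%:Z).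
Proof.
move=> le_lN.
under [RHS]eq_bigr => i _ do rewrite -binomial_alternating_sum mulr_sumr.
rewrite exchange_big /=; apply: eq_bigr => j _.
have le_jN : (j <= N)%N by apply: leq_trans le_lN; rewrite -ltnS.
rewrite -mulnA -bin_expansion // PoszM (big_morph Posz PoszD (erefl _)) !mulr_sumr.
apply: eq_bigr => i _; rewrite !PoszM; ring.
Qed.

(** With z = 1/9, [padeP / 9 ^ l] and [padeQ / 9 ^ n] are the values of the numerator, of degree l,
    and the denominator, of degree n, of the Pade approximant of (1 - z) ^ (N - n). *)
Definition padeQ (l n N : nat) : nat :=
  (\sum_(i < N.+1 | i <= n) 'C(N, i) * 'C(l + n - i, l) * 8 ^ (n - i))%N.

Definition padeR (l n N : nat) : nat :=
  (\sum_(i < N.+1 | n < i) 'C(N, i) * 'C(i - n.+1, l) * 8 ^ (N - i))%N.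

Definition padeP (l n N : nat) : int :=
  \sum_(j < l.+1) (-1) ^+ j * ('C(l + n - j, n) * 'C(N, j) * 9 ^ (l - j))%:Z.

Lemma pade_relation (l n M : nat) : (n <= l + M)%N ->
  (9 ^ M)%:Z * padeP l n (l + M) =
  (8 ^ (l + M - n) * padeQ l n (l + M))%:Z + (-1) ^+ l * (padeR l n (l + M))%:Z.
Proof.
set N := (l + M)%N => le_nN.
have -> : (9 ^ M)%:Z * padeP l n N =
    \sum_(j < l.+1) (-1) ^+ j * ('C(l + n - j, n) * 'C(N, j) * 9 ^ (N - j))%:Z.
  rewrite /padeP mulr_sumr; apply: eq_bigr => j _.
  have -> : (N - j = M + (l - j))%N by have := ltn_ord j; lia.
  by rewrite expnD !PoszM; ring.
rewrite pade_identity ?leq_addr // (bigID (fun i : 'I_N.+1 => (i <= n)%N)) /=.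
congr (_ + _).
  rewrite PoszM /padeQ (big_morph Posz PoszD (erefl _)) mulr_sumr.
  apply: eq_bigr => i le_in; rewrite le_in; have -> : (N - i = N - n + (n - i))%N by lia.
  by rewrite expnD !PoszM; ring.
rewrite /padeR (big_morph Posz PoszD (erefl _)) mulr_sumr.
apply: eq_big => [i|i]; first by rewrite -ltnNge.
by move/negbTE => ->; rewrite !PoszM; ring.
Qed.

Lemma padeQ_gt0 l n N : (n <= N)%N -> (0 < padeQ l n N)%N.
Proof.
move=> le_nN; rewrite /padeQ (bigD1 (inord n)) /= inordK ?ltnS // ltn_addr //.
by rewrite subnn muln1 addnK binn muln1 bin_gt0.
Qed.

Lemma dvdn_padeQ W l n N :
  (forall i, (i <= n)%N -> (W %| 'C(N, i) * 'C(l + n - i, l))%N) -> (W %| padeQ l n N)%N.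
Proof.
by move=> dvdW; apply: dvdn_sum => i le_in; rewrite dvdn_mulr ?dvdW.
Qed.

Lemma dvdz_padeP W l n N :
  (forall j, (j <= l)%N -> (W %| 'C(l + n - j, n) * 'C(N, j))%N) ->
  (W%:Z %| padeP l n N)%Z.
Proof.
move=> dvdW; rewrite /padeP; apply: rpred_sum => j _.
by rewrite dvdz_mull // PoszM dvdz_mulr // dvdzE /= dvdW // -ltnS.
Qed.

Lemma pade_lower_bound (W l n M r : nat) (X s : int) :
  M = (3 * (l - n))%N -> (n <= l)%N ->
  (forall i, (i <= n)%N -> (W %| 'C(l + M, i) * 'C(l + n - i, l))%N) ->
  (forall j, (j <= l)%N -> (W %| 'C(l + n - j, n) * 'C(l + M, j))%N) ->
  (4 ^ (2 * M + r))%:Z = (9 ^ M)%:Z * X + s ->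
  0 < (-1) ^+ l * s ->
  (9 ^ M * W <= `|s| * padeQ l n (l + M) + 4 ^ r * padeR l n (l + M))%N.
Proof.
move=> defM le_nl dvdQ dvdP def4 s_pos.
have le_nN : (n <= l + M)%N by lia.
have := pade_relation _ _ _ le_nN; have := padeQ_gt0 l _ _ le_nN.
have /dvdnP[q defQ] := dvdn_padeQ _ _ _ _ dvdQ.
have /dvdzP[p defP] := dvdz_padeP _ _ _ _ dvdP.
set Q := padeQ _ _ _ in defQ *; set R := padeR _ _ _; set P := padeP _ _ _ in defP *.
move=> Q_gt0 rel.
pose E := (4 ^ r)%:Z * P - X * Q%:Z.
have eqE : (9 ^ M)%:Z * E = s * Q%:Z + (-1) ^+ l * (4 ^ r * R)%:Z.
  (* As powers of 2 the exponents are 2 r + 3 (l + M - n) and 2 (2 M + r), equal because M = 3 (l -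
     n). *)
  have e4 : (4 ^ r * 8 ^ (l + M - n) = 4 ^ (2 * M + r))%N.
    rewrite -[8%N]/((2 ^ 3)%N) -[4%N]/((2 ^ 2)%N) -!expnM -expnD.
    by congr (_ ^ _)%N; lia.
  rewrite /E mulrBr mulrCA rel mulrDr.
  have -> : (4 ^ r)%:Z * (8 ^ (l + M - n) * Q)%:Z = ((9 ^ M)%:Z * X + s) * Q%:Z.
    by rewrite -def4 -e4 !PoszM; ring.
  by rewrite !PoszM; ring.
have E_div : (W%:Z %| E)%Z.
  apply: rpredB; apply: dvdz_mull; first by rewrite defP dvdz_mull.
  by rewrite dvdzE /= defQ dvdn_mull.
have E_neq0 : E != 0.
  apply: contraTneq s_pos => E0.
  have : (-1) ^+ l * s * Q%:Z + (4 ^ r * R)%:Z = 0.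
    have /eqP := eqE; rewrite E0 mulr0 => /eqP/(congr1 ( *%R ((-1) ^+ l))).
    by rewrite mulr0 mulrDr !mulrA -expr2 sqrr_sign mul1r => <-.
  move=> e; rewrite -leNgt; nia.
have le_W : (W <= `|E|)%N by apply: dvdn_leq; rewrite ?absz_gt0.
have : (9 ^ M * W <= `|((9 ^ M)%:Z * E)%R|)%N by rewrite abszM leq_mul2l le_W orbT.
move/leq_trans; apply; rewrite eqE.
have norm_add (u v : int) : (`|(u + v)%R| <= `|u| + `|v|)%N.
  by rewrite -lez_nat PoszD !abszE ler_normD.
by apply: leq_trans (norm_add _ _) _; rewrite !abszM abszX exp1n mul1n.
Qed.

(** * Upper bounds for Q and R *)

Lemma bin_weight (a c l t : nat) : ('C(l + t, l) * (c ^ l * a ^ t) <= (a + c) ^ (l + t))%N.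
Proof.
rewrite expnDn (bigD1 (inord l)) //= inordK; last by rewrite ltnS leq_addr.
by rewrite addKn [(c ^ l * _)%N]mulnC leq_addr.
Qed.

(** A saddle point bound in integers: each binomial is bounded by a weighted power, and what remains
    is part of one binomial expansion. The parameter is a / (a + c); for l, n, N in the ratios 23 :
    13 : 53 its optimum is close to 8 / 25. *)
Lemma padeQ_upper (a c l n N : nat) : (n <= N)%N ->
  (padeQ l n N * (c ^ l * a ^ n * (8 * (a + c)) ^ (N - n)) <=
   (a + c) ^ l * (8 * (a + c) + a) ^ N)%N.
Proof.
move=> le_nN; rewrite /padeQ big_distrl (expnDn (8 * (a + c)) a) big_distrr /=.
rewrite [leqRHS](bigID (fun i : 'I_N.+1 => (i <= n)%N)) /= -[leqLHS]addn0 leq_add //.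
apply: leq_sum => i le_in.
have := bin_weight a c l (n - i); rewrite addnBA // => le_bin.
have -> : ((8 * (a + c)) ^ (N - i) = (8 * (a + c)) ^ (N - n) * ((a + c) ^ (n - i) * 8 ^ (n - i)))%N.
  by rewrite [((a + c) ^ _ * _)%N]mulnC -expnMn -expnD; congr (_ ^ _)%N; lia.
have -> : (a ^ n = a ^ (n - i) * a ^ i)%N by rewrite -expnD subnK.
have := leq_mul le_bin (leqnn ('C(N, i) * 8 ^ (n - i) * a ^ i * (8 * (a + c)) ^ (N - n))%N).
rewrite -addnBA // expnD => h.
by apply: leq_trans (leq_trans h _); [apply: eq_leq; ring|apply: eq_leq; ring].
Qed.

(** The same method; here the optimum of a / (a + c) is close to 1 / 19. *)
Lemma padeR_upper (a c l n N : nat) : (n + l < N)%N ->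
  (padeR l n N * (c ^ l * a ^ (N - n - l.+1) * (a + c) ^ n.+1) <= (8 * a + (a + c)) ^ N)%N.
Proof.
move=> lt_N; rewrite /padeR big_distrl (expnDn (8 * a)) /=.
rewrite [leqRHS](bigID (fun i : 'I_N.+1 => (n < i)%N)) /= -[leqLHS]addn0 leq_add //.
apply: leq_sum => i lt_ni.
have [lt_i|le_i] := ltnP (i - n.+1) l; first by rewrite (bin_small lt_i) muln0 !mul0n.
have := bin_weight a c l (i - n.+1 - l); rewrite subnKC // => le_bin.
have le_iN := ltn_ord i.
have -> : (a ^ (N - n - l.+1) = a ^ (i - n.+1 - l) * a ^ (N - i))%N.
  by rewrite -expnD; congr (_ ^ _)%N; lia.
have -> : ((a + c) ^ i = (a + c) ^ (i - n.+1) * (a + c) ^ n.+1)%N.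
  by rewrite -expnD; congr (_ ^ _)%N; lia.
rewrite expnMn.
have := leq_mul le_bin (leqnn ('C(N, i) * 8 ^ (N - i) * a ^ (N - i) * (a + c) ^ n.+1)%N) => h.
by apply: leq_trans (leq_trans h _); [apply: eq_leq; ring|apply: eq_leq; ring].
Qed.

(** ** Logarithms of factorials and of the common divisor *)

Lemma lnM (x y : R) : 0 < x -> 0 < y -> ln (x * y) = ln x + ln y.
Proof. by move=> /RltP hx /RltP hy; apply: ln_mult. Qed.

Lemma ln1 : ln (1 : R) = 0. Proof. exact: ln_1. Qed.

Lemma ln_le_mono (x y : R) : 0 < x -> x <= y -> ln x <= ln y.
Proof.
move=> x_gt0; rewrite le_eqVlt => /orP[/eqP->//|/RltP lt_xy].
by apply/RleP/Rlt_le; apply: ln_increasing => //; apply/RltP.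
Qed.

Lemma ln_natM (a b : nat) : (0 < a)%N -> (0 < b)%N ->
  ln ((a * b)%:R : R) = ln (a%:R) + ln (b%:R).
Proof. by move=> a_gt0 b_gt0; rewrite natrM lnM // ltr0n. Qed.

Lemma ln_natX (a e : nat) : (0 < a)%N -> ln ((a ^ e)%:R : R) = e%:R * ln (a%:R).
Proof.
move=> a_gt0; elim: e => [|e IH]; first by rewrite expn0 mul0r ln1.
by rewrite expnS ln_natM ?expn_gt0 ?a_gt0 // IH -addn1 natrD mulrDl mul1r addrC.
Qed.

Lemma ln_nat_ge0 (n : nat) : 0 <= ln (n.+1%:R : R).
Proof. by rewrite -ln1 ln_le_mono // ler1n. Qed.

Lemma ln_nat_le (a b : nat) : (0 < a)%N -> (a <= b)%N -> ln (a%:R : R) <= ln (b%:R).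
Proof. by move=> a_gt0 le_ab; rewrite ln_le_mono ?ltr0n ?ler_nat. Qed.

(* The sum of [ln p * F q] over the prime powers q = p ^ k, i.e. F against von Mangoldt's measure. *)
Definition mangoldt (K : nat) (F : nat -> R) : R :=
  \sum_(p < K | prime p) \sum_(1 <= k < K) ln (p%:R) * F (p ^ k)%N.

Lemma eq_mangoldt K F G : (forall q, (0 < q)%N -> F q = G q) -> mangoldt K F = mangoldt K G.
Proof.
move=> eqFG; apply: eq_bigr => p p_pr; apply: eq_bigr => k _.
by rewrite eqFG // expn_gt0 prime_gt0.
Qed.

Lemma le_mangoldt K F G : (forall q, (0 < q)%N -> F q <= G q) -> mangoldt K F <= mangoldt K G.
Proof.
move=> leFG; apply: ler_sum => p p_pr; apply: ler_sum => k _.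
rewrite ler_wpM2l ?leFG ?expn_gt0 ?prime_gt0 //.
by case: (p : nat) p_pr => // p' _; apply: ln_nat_ge0.
Qed.

Lemma mangoldtD K F G : mangoldt K (fun q => F q + G q) = mangoldt K F + mangoldt K G.
Proof.
rewrite -big_split; apply: eq_bigr => p _; rewrite -big_split; apply: eq_bigr => k _.
by rewrite /= mulrDr.
Qed.

Lemma mangoldtZ K c F : mangoldt K (fun q => c * F q) = c * mangoldt K F.
Proof.
rewrite mulr_sumr; apply: eq_bigr => p _; rewrite mulr_sumr; apply: eq_bigr => k _.
by rewrite mulrCA.
Qed.

Lemma mangoldt0 K : mangoldt K (fun=> 0) = 0.
Proof. by rewrite /mangoldt big1 // => p _; rewrite big1 // => k _; rewrite mulr0. Qed.

Lemma mangoldt_sum K (I : Type) (s : seq I) (F : I -> nat -> R) :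
  mangoldt K (fun q => \sum_(i <- s) F i q) = \sum_(i <- s) mangoldt K (F i).
Proof.
elim: s => [|i s IH].
  by rewrite big_nil -[RHS](mangoldt0 K); apply: eq_mangoldt => q _; rewrite big_nil.
by rewrite big_cons -IH -mangoldtD; apply: eq_mangoldt => q _; rewrite big_cons.
Qed.

Lemma ln_prod_prime_powers K (e : nat -> nat) :
  ln ((\prod_(p < K | prime p) p ^ e p)%N%:R : R) = \sum_(p < K | prime p) (e p)%:R * ln (p%:R).
Proof.
have [] : (0 < \prod_(p < K | prime p) p ^ e p)%N /\
  ln ((\prod_(p < K | prime p) p ^ e p)%N%:R : R) = \sum_(p < K | prime p) (e p)%:R * ln (p%:R) => //.
apply: (big_ind2 (fun (x : nat) (y : R) => (0 < x)%N /\ ln (x%:R : R) = y)).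
- by split; rewrite // ln1.
- by move=> x1 y1 x2 y2 [h1 <-] [h2 <-]; rewrite muln_gt0 h1 h2 ln_natM.
- by move=> p p_pr; rewrite expn_gt0 prime_gt0 // ln_natX ?prime_gt0.
Qed.

Lemma ln_prod_mangoldt K (F : nat -> nat) :
  ln ((\prod_(p < K | prime p) p ^ (\sum_(1 <= k < K) F (p ^ k)%N))%N%:R : R) =
  mangoldt K (fun q => (F q)%:R).
Proof.
rewrite (ln_prod_prime_powers K (fun p => \sum_(1 <= k < K) F (p ^ k))%N).
apply: eq_bigr => p _; rewrite natr_sum mulr_suml; apply: eq_bigr => k _.
by rewrite mulrC.
Qed.

Lemma prod_logn n K : (0 < n)%N -> (forall p, prime p -> (p %| n)%N -> (p < K)%N) ->
  (\prod_(p < K | prime p) p ^ logn p n)%N = n.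
Proof.
move=> n_gt0 ltK; apply/eqP; rewrite eqn_dvd; apply/andP; split.
  by apply: (prod_prime_powers_dvdn K (logn^~ n)) => p p_pr _; apply: pfactor_dvdnn.
apply/dvdn_partP => // p; rewrite mem_primes => /and3P[p_pr _ p_dvd].
rewrite p_part (bigD1 (Ordinal (ltK p p_pr p_dvd))) //=.
exact: dvdn_mulr.
Qed.

(** Legendre's formula, as an integral of [n / q] against von Mangoldt's measure. *)
Lemma ln_fact n K : (n < K)%N -> ln (n`!%:R : R) = mangoldt K (fun q => (n %/ q)%:R).
Proof.
move=> lt_nK; rewrite -{1}(prod_logn n`! K) ?fact_gt0 //; last first.
  move=> p p_pr p_dvd; rewrite ltnNge; apply/negP => le_Kp.
  have : (0 < logn p n`!)%N by rewrite logn_gt0 mem_primes p_pr fact_gt0.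
  rewrite logn_fact // big_nat_cond big1 // => k /andP[/andP[k_gt0 _] _].
  apply: divn_small; apply: leq_trans lt_nK (leq_trans le_Kp _).
  by rewrite -{1}[p]expn1 leq_exp2l ?prime_gt1.
rewrite -(ln_prod_mangoldt K (fun q => n %/ q)%N).
congr (ln _%:R); apply: eq_bigr => p p_pr.
by rewrite logn_fact // (sum_divn_widen p n K) ?prime_gt1.
Qed.

Definition psi (K n : nat) : R := mangoldt K (fun q => (q <= n)%:R).

Lemma central_bin_upper a b : (a <= b <= a.+1)%N -> ('C(a + b, a) <= 2 ^ (a + a))%N.
Proof.
case/andP=> le_ab; rewrite leq_eqVlt ltnS => /orP[/eqP->|le_ba].
  rewrite -(leq_pmul2l (m := 2)) // -expnS addnS -[2%N in leqRHS]/(1 + 1)%N expnDn.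
  have lt_a : (a < (a + a).+2)%N by lia.
  have lt_a1 : (a.+1 < (a + a).+2)%N by lia.
  rewrite (bigD1 (Ordinal lt_a)) // (bigD1 (Ordinal lt_a1)) //=; last first.
    by apply/eqP => /(congr1 val) /=; lia.
  have -> : 'C((a + a).+1, a.+1) = 'C((a + a).+1, a).
    by rewrite -[in RHS]bin_sub; [congr 'C(_, _); lia|lia].
  by rewrite !exp1n !muln1; lia.
have -> : b = a by apply/eqP; rewrite eqn_leq le_ba le_ab.
rewrite -[2%N]/(1 + 1)%N expnDn (bigD1 (inord a)) //= inordK ?ltnS ?leq_addr //.
by rewrite !exp1n !muln1 leq_addr.
Qed.

(** For b < q <= a + b the difference [(a + b) / q] - [a / q] - [b / q] is 1, and it is never
    negative; so psi(a + b) - psi(b) is at most the logarithm of the central binomial. *)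
Lemma psi_step K a b : (a <= b <= a.+1)%N -> (a + b < K)%N ->
  psi K (a + b) <= psi K b + (a + a)%:R * ln 2%:R.
Proof.
move=> leab lt_K.
have : ln ('C(a + b, a)%:R : R) <= (a + a)%:R * ln 2%:R.
  by rewrite -ln_natX // ln_nat_le ?bin_gt0 ?leq_addr // central_bin_upper.
move=> h; apply: le_trans (lerD (lexx _) h).
have -> : ln ('C(a + b, a)%:R : R) = ln ((a + b)`!%:R) - ln (a`!%:R) - ln (b`!%:R).
  have /bin_fact <- := leq_addr b a.
  by rewrite addKn !ln_natM ?muln_gt0 ?fact_gt0 ?bin_gt0 ?leq_addr //; ring.
rewrite !(ln_fact _ K); try lia.
rewrite /psi -[- mangoldt K _]mulN1r -[X in _ - X]mul1r -mulNr -!mangoldtZ -!mangoldtD.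
apply: le_mangoldt => q q_gt0; rewrite !mulN1r.
have : ((q <= a + b) + a %/ q + b %/ q <= (q <= b) + (a + b) %/ q)%N.
  rewrite divnD //; have [_|lt_bq] := leqP q b; first by case: (q <= a + b)%N => /=; lia.
  have lt_aq : (a < q)%N by case/andP: leab => le_ab _; apply: leq_ltn_trans lt_bq.
  by rewrite !modn_small // add0n -addnA addnC leqnn.
by rewrite -(ler_nat R) !natrD; lra.
Qed.

Lemma psi_upper K n : (n < K)%N -> psi K n <= n%:R * ln 4%:R.
Proof.
elim/ltn_ind: n => n IH lt_nK.
have [n_le1|n_gt1] := leqP n 1.
  rewrite /psi (_ : mangoldt _ _ = 0); last first.
    rewrite -[RHS](mangoldt0 K) /mangoldt; apply: eq_bigr => p p_pr.
    rewrite big_nat_cond [RHS]big_nat_cond; apply: eq_bigr => k /andP[/andP[k_gt0 _] _].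
    rewrite leqNgt (leq_ltn_trans n_le1) // -(prednK k_gt0) expnS.
    by rewrite (leq_trans (prime_gt1 p_pr)) // leq_pmulr // expn_gt0 prime_gt0.
  by rewrite mulr_ge0 ?ler0n // ln_nat_ge0.
pose a := n./2; pose b := (n - a)%N.
have eab : (a + b = n)%N by rewrite /a /b; lia.
have := psi_step K a b; rewrite eab => /(_ _ lt_nK) h.
apply: le_trans (h _) _; first by rewrite /a /b; lia.
have hb : psi K b <= b%:R * ln 4%:R by apply: IH; rewrite /b /a; lia.
apply: le_trans (lerD hb (lexx _)) _.
have -> : ln (4%:R : R) = 2%:R * ln (2%:R) by rewrite -(ln_natX 2 2).
by rewrite -eab !natrD; lra.
Qed.

(** * From the integer certificate to a lower bound for the common divisor *)

Import LogarithmBounds BinaryLogarithm Sweep PrimeWalk FarPowers.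

Definition zsum {A : Type} (F : A -> Z) (s : seq A) : Z := foldr (fun x => Z.add (F x)) Z0 s.

Lemma total_map {A : Type} T (F : A -> list event) (G : A -> Z * Z) s :
  (forall x, List.In x s -> total_upto T (F x) = G x) ->
  List.fold_right (fun s => add2 (total_upto T s)) (Z0, Z0) (List.map F s) =
  (zsum (fun x => fst (G x)) s, zsum (fun x => snd (G x)) s).
Proof.
elim: s => [|x s IH] eqFG //=.
by rewrite IH ?eqFG //=; [left|move=> y y_in; apply: eqFG; right].
Qed.

Lemma fold_add2_cat T l1 l2 :
  List.fold_right (fun s => add2 (total_upto T s)) (Z0, Z0) (l1 ++ l2)%list =
  add2 (List.fold_right (fun s => add2 (total_upto T s)) (Z0, Z0) l1)
       (List.fold_right (fun s => add2 (total_upto T s)) (Z0, Z0) l2).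
Proof. by elim: l1 => [|s l1 IH] /=; rewrite ?add2_0l // IH add2A. Qed.

Lemma zsum0 {A : Type} (s : seq A) : zsum (fun=> Z0) s = Z0.
Proof. by elim: s. Qed.

Lemma eq_zsum {A : Type} (F G : A -> Z) s : (forall x, F x = G x) -> zsum F s = zsum G s.
Proof. by move=> eqFG; elim: s => //= x s ->; rewrite eqFG. Qed.

Section Certificate.
#[local] Opaque factorials losses period time_unit top_coefficient.
Local Open Scope Z_scope.

Definition jump (T : Z) : Z :=
  T / period 53 1 - T / period 23 1 - T / period 17 1 - T / period 13 1.

Lemma factorial_periods_gt0 x : List.In x factorials -> 0 < period (fst (fst x)) (snd (fst x)).
Proof.
have := certificate_holds; rewrite /certificate_ok => /andP[h _] x_in.
by apply/Z.ltb_lt; exact: (proj1 (List.forallb_forall _ _) h x x_in).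
Qed.

Lemma certificate_below T : 0 <= T < horizon ->
  zsum (fun x => snd x * (T / period (fst (fst x)) (snd (fst x)))) factorials +
    top_coefficient * (T / time_unit) <=
  (if 2 <=? jump T then 60 else 0) + zsum (fun x => if fst x <=? T then snd x else 0) losses.
Proof.
move=> range; have := certificate_holds; rewrite /certificate_ok => /andP[_ h].
have := sweep_correct _ _ _ _ T h (proj1 range); clear h.
rewrite add2_0l total_merge_all /all_events !fold_add2_cat.
rewrite (total_map T _ (fun x => (T / period (fst (fst x)) (snd (fst x)) * snd x,
                                 T / period (fst (fst x)) (snd (fst x)) * 0))); last first.
  move=> x [<-|/factorial_periods_gt0 pos]; first by rewrite total_ticks_upto.
  by rewrite total_ticks_upto.
rewrite (total_map T _ (fun x => (T / period (fst x) 1 * 0, T / period (fst x) 1 * snd x))); last first.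
  by move=> x [<-|[<-|[<-|[<-|[]]]]]; rewrite total_ticks_upto.
rewrite (total_map T _ (fun x => (if fst x <=? T then - snd x else 0, 0))); last first.
  move=> [S h'] _ /=; case: ifP => // _; by rewrite /add2 /= Z.add_0_r.
rewrite /admissible /= => /Z.leb_le.
have -> : period 1 1 = time_unit by [].
rewrite !zsum0.
have -> : zsum (fun x => if fst x <=? T then - snd x else 0) losses =
  - zsum (fun x => if fst x <=? T then snd x else 0) losses.
  by elim: losses => //= x s ->; case: ifP => _; lia.
rewrite (eq_zsum (fun x : Z * Z * Z => T / period x.1.1 x.1.2 * x.2)
  (fun x => x.2 * (T / period x.1.1 x.1.2))); last by move=> x; apply: Z.mul_comm.
have -> : zsum (fun x : Z * Z * Z => T / period x.1.1 x.1.2 * 0) factorials = 0.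
  by rewrite -[RHS](zsum0 factorials); apply: eq_zsum => x; rewrite Z.mul_0_r.
rewrite /jump.
move: (zsum _ factorials) (zsum _ losses) (T / _) (T / _) (T / _) (T / _) (T / _) => A B C D E F G.
do 2 case: Z.leb_spec; lia.
Qed.
End Certificate.

#[local] Opaque factorials losses time_unit horizon.

Lemma natR_IZR (n : nat) : (n%:R : R) = IZR (Z.of_nat n).
Proof. by rewrite -INR_IZR_INZ INRE. Qed.

Lemma IZR_sum (A : Type) (F : A -> Z) s : \sum_(x <- s) IZR (F x) = IZR (zsum F s).
Proof. by elim: s => [|x s IH]; rewrite ?big_nil ?big_cons ?IH /= ?plus_IZR. Qed.

Lemma IZR_leP (x y : Z) : (x <= y)%ZZ -> IZR x <= IZR y.
Proof. by move=> h; apply/RleP/IZR_le. Qed.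

Lemma IZR_gt0 (x : Z) : (0 < x)%ZZ -> 0 < IZR x.
Proof. by move=> h; apply/RltP/IZR_lt. Qed.

Lemma floor_bounds (x d : Z) : (0 < d)%ZZ ->
  IZR x / IZR d - 1 <= IZR (x / d) <= IZR x / IZR d.
Proof.
move=> d_gt0; have dR := IZR_gt0 _ d_gt0.
have [lo hi] : (d * (x / d) <= x /\ x <= d * (x / d) + d)%ZZ.
  by have := Z.mul_div_le x d d_gt0; have := Z.mul_succ_div_gt x d d_gt0; lia.
have {}lo := IZR_leP _ _ lo; have {}hi := IZR_leP _ _ hi.
rewrite plus_IZR mult_IZR in hi; rewrite mult_IZR in lo.
apply/andP; split; last by rewrite ler_pdivlMr // mulrC.
by rewrite lerBlDr ler_pdivrMr // mulrDl mul1r mulrC.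
Qed.

Definition numer (x : Z * Z * Z) : Z := fst (fst x).
Definition denom (x : Z * Z * Z) : Z := snd (fst x).

Lemma factorials_wf x : List.In x factorials ->
  [/\ (0 < numer x)%ZZ, (0 < denom x)%ZZ & (numer x * (time_unit / numer x))%ZZ = time_unit].
Proof.
have wf : List.forallb (fun x => (0 <? numer x)%ZZ && (0 <? denom x)%ZZ &&
    (numer x * (time_unit / numer x) =? time_unit)%ZZ) factorials by vm_compute.
move=> x_in; have /andP[/andP[]] := proj1 (List.forallb_forall _ _) wf x x_in.
by move=> /Z.ltb_lt ? /Z.ltb_lt ? /Z.eqb_eq.
Qed.

Definition scaled (x : Z * Z * Z) (m : nat) : nat := Z.to_nat (numer x * Z.of_nat m / denom x).

Definition ratio (x : Z * Z * Z) := IZR (numer x) / IZR (denom x).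

(* The coefficient of [y] that cancels the linear growth of the combination. *)
Definition balance := - \sum_(x <- factorials) IZR (snd x) * ratio x.

Lemma big_In_ext (A : Type) (s : seq A) (F G : A -> R) :
  (forall x, List.In x s -> F x = G x) -> \sum_(x <- s) F x = \sum_(x <- s) G x.
Proof.
elim: s => [|x s IH] eqFG; first by rewrite !big_nil.
by rewrite !big_cons eqFG ?IH //=; [move=> y y_in; apply: eqFG; right|left].
Qed.

Lemma big_In_le (A : Type) (s : seq A) (F G : A -> R) :
  (forall x, List.In x s -> F x <= G x) -> \sum_(x <- s) F x <= \sum_(x <- s) G x.
Proof.
elim: s => [|x s IH] leFG; first by rewrite !big_nil.
by rewrite !big_cons lerD ?leFG ?IH //=; [left|move=> y y_in; apply: leFG; right].
Qed.

(** Fixed-point evaluation with six decimals; each floor errs by at most one unit, whence the sum of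
    ones. *)
Lemma balance_bounds : 0 <= balance <= 60.
Proof.
pose K := IZR 1000000.
have K_gt0 : 0 < K by apply: IZR_gt0.
pose s := zsum (fun x => snd x * numer x * 1000000 / denom x)%ZZ factorials.
have s_lo : (- (60) * 1000000 <= s)%ZZ by vm_compute.
have s_hi : (s + zsum (fun=> 1%ZZ) factorials <= 0)%ZZ by vm_compute.
have bounds x : List.In x factorials ->
  IZR (snd x * numer x * 1000000 / denom x) <= K * (IZR (snd x) * ratio x) <=
  IZR (snd x * numer x * 1000000 / denom x) + IZR 1.
  move=> /factorials_wf[_ d_gt0 _].
  have := floor_bounds (snd x * numer x * 1000000) _ d_gt0.
  rewrite !mult_IZR /ratio -/K; set u := IZR (_ / _)%ZZ.
  have -> : IZR (snd x) * IZR (numer x) * K / IZR (denom x) =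
    K * (IZR (snd x) * (IZR (numer x) / IZR (denom x))) by ring.
  by move=> /andP[lo hi]; apply/andP; split; [exact: hi|move: lo; rewrite lerBlDr].
have lo : IZR s <= K * (- balance).
  rewrite -IZR_sum opprK mulr_sumr; apply: big_In_le => x x_in.
  by have /andP[] := bounds x x_in.
have hi : K * (- balance) <= IZR (s + zsum (fun=> 1%ZZ) factorials).
  rewrite plus_IZR -!IZR_sum opprK mulr_sumr -big_split; apply: big_In_le => x x_in.
  by have /andP[] := bounds x x_in.
have {}s_lo := IZR_leP _ _ s_lo; have {}s_hi := IZR_leP _ _ s_hi.
have {}lo := le_trans s_lo lo; have {}hi := le_trans hi s_hi.
have {}lo : IZR (- (60)) <= - balance.
  rewrite -(ler_pM2l K_gt0); apply: le_trans lo.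
  by rewrite mult_IZR mulrC.
have {}hi : - balance <= 0 by rewrite -(ler_pM2l K_gt0) mulr0.
have e60 : IZR (- (60)) = - 60%:R by rewrite opp_IZR natR_IZR.
by rewrite e60 in lo; apply/andP; split; lra.
Qed.

Lemma losses_cover_negatives :
  (zsum (fun x => Z.max 0 (- snd x)) factorials <= zsum snd losses)%ZZ.
Proof. by vm_compute. Qed.

Lemma losses_before_horizon x : List.In x losses -> (0 < fst x <= horizon)%ZZ.
Proof.
have h : List.forallb (fun x => (0 <? fst x)%ZZ && (fst x <=? horizon)%ZZ) losses by vm_compute.
move=> x_in; have /andP[/Z.ltb_lt ? /Z.leb_le ?] := proj1 (List.forallb_forall _ _) h x x_in.
by [].
Qed.

Lemma losses_ge0 x : List.In x losses -> (0 <= snd x)%ZZ.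
Proof.
have h : List.forallb (fun x => (0 <=? snd x)%ZZ) losses by vm_compute.
by move=> x_in; apply/Z.leb_le; exact: (proj1 (List.forallb_forall _ _) h x x_in).
Qed.

Lemma Z_of_divn (a d : nat) : (0 < d)%N -> Z.of_nat (a %/ d) = (Z.of_nat a / Z.of_nat d)%ZZ.
Proof.
move=> d_gt0; apply: (Z.div_unique _ _ _ (Z.of_nat (a %% d))); first by have := ltn_pmod a d_gt0; lia.
by have := divn_eq a d; lia.
Qed.

Lemma Z_of_scaled x m : List.In x factorials ->
  Z.of_nat (scaled x m) = (numer x * Z.of_nat m / denom x)%ZZ.
Proof.
move=> /factorials_wf[n_gt0 d_gt0 _]; rewrite Z2Nat.id //.
by apply: Z.div_pos => //; lia.
Qed.

Lemma scaled_time x m q : (0 < q)%N -> List.In x factorials ->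
  Z.of_nat (scaled x m %/ q) =
  (time_unit * Z.of_nat m / Z.of_nat q / period (numer x) (denom x))%ZZ.
Proof.
move=> q_gt0 x_in; have [n_gt0 d_gt0 e] := factorials_wf x x_in.
have t_gt0 : (0 < time_unit / numer x)%ZZ.
  have : (0 < time_unit)%ZZ by vm_compute.
  by nia.
rewrite Z_of_divn // Z_of_scaled // !Z.div_div /period; try nia.
rewrite -{1}e (_ : numer x * (time_unit / numer x) * Z.of_nat m =
  (numer x * Z.of_nat m) * (time_unit / numer x))%ZZ; last by ring.
rewrite (_ : Z.of_nat q * (denom x * (time_unit / numer x)) =
  (denom x * Z.of_nat q) * (time_unit / numer x))%ZZ; last by ring.
by rewrite Z.div_mul_cancel_r; nia.
Qed.

Definition loss_index (x : Z * Z) (m : nat) : nat := Z.to_nat (time_unit * Z.of_nat m / fst x).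

Lemma loss_indexP x m q : (0 < q)%N -> List.In x losses ->
  (q <= loss_index x m)%N = (fst x <=? time_unit * Z.of_nat m / Z.of_nat q)%ZZ.
Proof.
move=> q_gt0 /losses_before_horizon[S_gt0 _].
have t_gt0 : (0 < time_unit)%ZZ by vm_compute.
have e : Z.of_nat (loss_index x m) = (time_unit * Z.of_nat m / fst x)%ZZ.
  by rewrite Z2Nat.id //; apply: Z.div_pos; nia.
apply/idP/idP => h.
  apply/Z.leb_le; apply: Z.div_le_lower_bound; first lia.
  have := Z.mul_div_le (time_unit * Z.of_nat m) _ S_gt0; rewrite -e; nia.
move/Z.leb_le in h; have : (Z.of_nat q <= Z.of_nat (loss_index x m))%ZZ; last lia.
rewrite e; apply: Z.div_le_lower_bound; first lia.
have q0 : (0 < Z.of_nat q)%ZZ by lia.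
have := Z.mul_div_le (time_unit * Z.of_nat m) _ q0; nia.
Qed.

(** With y = m / q, the hypothesis gives [53 y] - [23 y] - [13 y] >= [17 y] + 2 > 17 y + 1, and 17 =
    53 - 23 - 13 turns this into a statement on fractional parts. *)
Lemma jump_content m q : (0 < q)%N ->
  (2 <=? jump (time_unit * Z.of_nat m / Z.of_nat q))%ZZ ->
  content_at (23 * m) (13 * m) (53 * m) q.
Proof.
move=> q_gt0 /Z.leb_le; rewrite /jump.
have tick a : (0 < a)%ZZ -> (a * (time_unit / a) = time_unit)%ZZ ->
   (time_unit * Z.of_nat m / Z.of_nat q / period a 1 = Z.of_nat ((Z.to_nat a * m) %/ q))%ZZ.
  move=> a_gt0 e; have t_gt0 : (0 < time_unit / a)%ZZ.
    have : (0 < time_unit)%ZZ by vm_compute.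
    by nia.
  rewrite Z_of_divn // Nat2Z.inj_mul Z2Nat.id; last lia.
  rewrite Z.div_div /period; try nia.
  rewrite -{1}e (_ : a * (time_unit / a) * Z.of_nat m = (a * Z.of_nat m) * (time_unit / a))%ZZ; last by ring.
  by rewrite Z.mul_1_l Z.div_mul_cancel_r; nia.
rewrite !tick //; try by vm_compute.
rewrite /content_at.
have := divn_eq (53 * m) q; have := divn_eq (23 * m) q; have := divn_eq (13 * m) q.
have := divn_eq (17 * m) q; have := ltn_pmod (17 * m) q_gt0.
rewrite (_ : Z.to_nat 53 = 53)%N // (_ : Z.to_nat 23 = 23)%N // (_ : Z.to_nat 13 = 13)%N //.
rewrite (_ : Z.to_nat 17 = 17)%N //.
move: (53 * m %/ q)%N (23 * m %/ q)%N (17 * m %/ q)%N (13 * m %/ q)%N => a b c d.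
move: (53 * m %% q)%N (23 * m %% q)%N (17 * m %% q)%N (13 * m %% q)%N => a' b' c' d'.
move=> lt_c ec ed eb ea jump2.
have : (b * q + c * q + d * q + 2 * q <= a * q)%N by rewrite -!mulnDl leq_mul2r; apply/orP; right; lia.
by lia.
Qed.
Lemma certificate_pointwise m q : (0 < q)%N ->
  \sum_(x <- factorials) IZR (snd x) * (scaled x m %/ q)%:R + balance * (m %/ q)%:R <=
  60 * (content_at (23 * m) (13 * m) (53 * m) q)%:R +
  \sum_(x <- losses) IZR (snd x) * (q <= loss_index x m)%:R.
Proof.
move=> q_gt0; set T := (time_unit * Z.of_nat m / Z.of_nat q)%ZZ.
have t_gt0 : (0 < time_unit)%ZZ by vm_compute.
have T_ge0 : (0 <= T)%ZZ by apply: Z.div_pos; nia.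
have [bal_ge0 bal_le] := andP balance_bounds.
have -> : \sum_(x <- losses) IZR (snd x) * (q <= loss_index x m)%:R =
    IZR (zsum (fun x => if fst x <=? T then snd x else 0)%ZZ losses).
  rewrite -IZR_sum; apply: big_In_ext => x x_in.
  by rewrite loss_indexP // -/T; case: (_ <=? _)%ZZ; rewrite ?mulr1 ?mulr0.
have -> : \sum_(x <- factorials) IZR (snd x) * (scaled x m %/ q)%:R =
    IZR (zsum (fun x => snd x * (T / period (fst (fst x)) (snd (fst x))))%ZZ factorials).
  rewrite -IZR_sum; apply: big_In_ext => x x_in.
  by rewrite natR_IZR scaled_time // mult_IZR.
have [lt_T|le_T] := Z.lt_ge_cases T horizon.
  have := certificate_below T (conj T_ge0 lt_T).
  move: (zsum _ factorials) (zsum _ losses) => A B /IZR_leP; rewrite !plus_IZR => h.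
  have eT : (T / time_unit)%ZZ = Z.of_nat (m %/ q).
    rewrite Z_of_divn // /T Z.div_div; try lia.
    rewrite (_ : time_unit * Z.of_nat m = Z.of_nat m * time_unit)%ZZ; last by ring.
    by rewrite Z.div_mul_cancel_r; lia.
  rewrite eT mult_IZR -natR_IZR ?RplusE ?RmultE in h.
  have top : IZR top_coefficient = 60%:R by rewrite natR_IZR.
  rewrite top in h.
  have : balance * (m %/ q)%:R <= 60%:R * (m %/ q)%:R by rewrite ler_wpM2r ?ler0n.
  have : IZR (if 2 <=? jump T then 60 else 0)%ZZ <=
         60 * (content_at (23 * m) (13 * m) (53 * m) q)%:R :> R.
    have := jump_content m q q_gt0; rewrite -/T; case: (_ <=? _)%ZZ.
      by move=> /(_ isT) ->; rewrite mulr1 [leRHS]natR_IZR.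
    by move=> _; rewrite mulr_ge0 ?ler0n.
  by lra.
(* Past the horizon all losses are charged. The linear parts cancel by the choice of [balance], and
   replacing the floors by their arguments costs at most the absolute value of each negative
   coefficient. *)
have -> : zsum (fun x => if fst x <=? T then snd x else 0)%ZZ losses = zsum snd losses.
  have h x : List.In x losses -> (fst x <=? T)%ZZ.
    by move=> /losses_before_horizon[_ le_h]; apply/Z.leb_le; lia.
  elim: losses h => //= x s IH h; rewrite h; last by left.
  by rewrite IH // => y y_in; apply: h; right.
apply: (@le_trans _ _ (IZR (zsum snd losses))); last by rewrite lerDr mulr_ge0 ?ler0n.
have := losses_cover_negatives => /IZR_leP; apply: le_trans.
rewrite -!IZR_sum; pose y := (m%:R : R) / q%:R.
have y_ge0 : 0 <= y by rewrite divr_ge0 ?ler0n.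
have fl_y : (m %/ q)%:R <= y.
  by rewrite ler_pdivlMr ?ltr0n // -natrM ler_nat leq_divM.
apply: (@le_trans _ _ (\sum_(x <- factorials)
  (IZR (snd x) * (ratio x) * y + IZR (Z.max 0 (- snd x))) + balance * y)).
  rewrite lerD ?ler_wpM2l //; apply: big_In_le => x x_in.
  have [n_gt0 d_gt0 _] := factorials_wf x x_in.
  have -> : (T / period (fst (fst x)) (snd (fst x)))%ZZ =
      (numer x * Z.of_nat m / (denom x * Z.of_nat q))%ZZ.
    rewrite -scaled_time // Z_of_divn // Z_of_scaled // Z.div_div //; lia.
  have dq_gt0 : (0 < denom x * Z.of_nat q)%ZZ by nia.
  have := floor_bounds (numer x * Z.of_nat m) _ dq_gt0.
  set fl := IZR (_ / _)%ZZ.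
  have -> : IZR (numer x * Z.of_nat m) / IZR (denom x * Z.of_nat q) = ratio x * y.
    rewrite !mult_IZR !RmultE /ratio /y !natR_IZR.
    have : IZR (denom x) != 0 by rewrite gt_eqF // IZR_gt0.
    have : IZR (Z.of_nat q) != 0 by rewrite gt_eqF //; apply: IZR_gt0; lia.
    move: (IZR _) (IZR _) (IZR _) (IZR _) => a b c d a0 c0.
    by field; rewrite a0 c0.
  move=> /andP[lo hi]; rewrite mult_IZR RmultE -/fl.
  have [e_ge0|e_lt0] := Z.le_gt_cases 0 (snd x).
    have {}e_ge0 := IZR_leP _ _ e_ge0.
    rewrite -mulrA; apply: (@le_trans _ _ (IZR (snd x) * (ratio x * y))).
      by rewrite ler_wpM2l.
    by rewrite lerDl; apply: (IZR_leP 0); lia.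
  rewrite Z.max_r; last lia.
  have {}e_lt0 : IZR (snd x) < 0.
    by rewrite -oppr_gt0 -RoppE -opp_IZR; apply: IZR_gt0; lia.
  by rewrite opp_IZR RoppE -mulrA; move: lo; rewrite -(ler_nM2l e_lt0) mulrBr mulr1.
rewrite big_split /= -mulr_suml addrAC -mulrDl /balance subrr mul0r add0r.
exact: lexx.
Qed.

Lemma scaled_le x m : List.In x factorials -> (scaled x m <= 53 * m)%N.
Proof.
move=> x_in; have [n_gt0 d_gt0 _] := factorials_wf x x_in.
have h : List.forallb (fun x => (numer x <=? 53)%ZZ) factorials by vm_compute.
have /Z.leb_le le53 := proj1 (List.forallb_forall _ _) h x x_in.
have : (Z.of_nat (scaled x m) <= 53 * Z.of_nat m)%ZZ; last lia.
rewrite Z_of_scaled //; apply: Z.div_le_upper_bound => //; nia.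
Qed.

Lemma loss_index_le x m : List.In x losses ->
  IZR (fst x) * (loss_index x m)%:R <= IZR time_unit * m%:R.
Proof.
move=> /losses_before_horizon[S_gt0 _].
have t_gt0 : (0 < time_unit)%ZZ by vm_compute.
rewrite !natR_IZR -!RmultE -!mult_IZR; apply: IZR_leP.
rewrite Z2Nat.id; last by apply: Z.div_pos; nia.
exact: Z.mul_div_le.
Qed.

Lemma loss_index_lt x m K : List.In x losses -> (53 * m < K)%N -> (loss_index x m < K)%N.
Proof.
move=> x_in; apply: leq_ltn_trans.
have h : List.forallb (fun x => (time_unit <=? fst x)%ZZ) losses by vm_compute.
have /Z.leb_le leS := proj1 (List.forallb_forall _ _) h x x_in.
have t_gt0 : (0 < time_unit)%ZZ by vm_compute.
have : (Z.of_nat (loss_index x m) <= Z.of_nat m)%ZZ; last lia.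
rewrite Z2Nat.id; last by apply: Z.div_pos; nia.
by apply: Z.div_le_upper_bound; nia.
Qed.

(** Integrating the pointwise inequality against von Mangoldt's measure turns floors into
    factorials, the indicator into ln W, and the losses into values of psi. *)
Lemma content_lower m K : (53 * m < K)%N ->
  \sum_(x <- factorials) IZR (snd x) * ln ((scaled x m)`!%:R) + balance * ln (m`!%:R) <=
  60 * ln ((content (23 * m) (13 * m) (53 * m) K)%:R) +
  \sum_(x <- losses) IZR (snd x) * ((loss_index x m)%:R * ln 4%:R).
Proof.
move=> lt_K.
rewrite /content (ln_prod_mangoldt K (content_at (23 * m) (13 * m) (53 * m))).
have := le_mangoldt K _ _ (certificate_pointwise m).
rewrite !mangoldtD !mangoldt_sum !mangoldtZ -ln_fact; last by lia.
have -> : \sum_(x <- factorials) mangoldt K (fun q => IZR (snd x) * (scaled x m %/ q)%:R) =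
  \sum_(x <- factorials) IZR (snd x) * ln ((scaled x m)`!%:R).
  apply: big_In_ext => x x_in; rewrite mangoldtZ -ln_fact //.
  by apply: leq_ltn_trans lt_K; apply: scaled_le.
move/le_trans; apply; rewrite lerD //; apply: big_In_le => x x_in.
rewrite mangoldtZ ler_wpM2l //; first by apply: (IZR_leP 0); apply: losses_ge0.
by apply: psi_upper; apply: loss_index_lt.
Qed.

(** * Numerical evaluation by Stirling's formula *)

Definition log2_ratio (x : Z * Z * Z) : Z :=
  if (0 <=? snd x)%ZZ then log2_lower 17 (numer x) (denom x) else log2_lower 17 (denom x) (numer x).

(** Logarithms are in units of 2 ^ (-17) bit. [main_term] and [log_term] are lower bounds for the
    sums of e (a / b) log2 (a / b) and of - |e| log2 (a / b), [loss_term] is an upper bound for the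
    scaled losses, and [constant_term] is four times the constants 3/4 and 1 of Stirling's bounds,
    weighted by e. *)
Definition main_term : Z :=
  zsum (fun x => Z.abs (snd x) * numer x * log2_ratio x / denom x)%ZZ factorials.
Definition loss_term : Z :=
  zsum (fun x => snd x * time_unit * 131072 / fst x + 1)%ZZ losses.
Definition weight : Z := zsum (fun x => Z.abs (snd x)) factorials.
Definition log_term : Z :=
  zsum (fun x => Z.abs (snd x) * log2_lower 17 (denom x) (numer x))%ZZ factorials.
Definition constant_term : Z :=
  zsum (fun x => if 0 <=? snd x then 3 * snd x else 4 * snd x)%ZZ factorials.

Lemma certificate_terms : [/\ main_term = 56752510, loss_term = 3962960, weight = 3982,
  log_term = - (179485679) & constant_term = - (1858)]%ZZ.
Proof. by split; vm_compute. Qed.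

Lemma factorials_log x : List.In x factorials ->
  [/\ log2_valid (numer x) (denom x), log2_valid (denom x) (numer x) &
     (denom x <= 71 * numer x)%ZZ].
Proof.
have h : List.forallb (fun x => log2_valid (numer x) (denom x) &&
    log2_valid (denom x) (numer x) && (denom x <=? 71 * numer x)%ZZ) factorials by vm_compute.
move=> x_in; have /andP[/andP[]] := proj1 (List.forallb_forall _ _) h x x_in.
by clear h => ? ? /Z.leb_le.
Qed.

Lemma fact_upper n (x : R) : (1 <= n)%N -> n%:R <= x ->
  ln (n`!%:R) <= x * ln x - x + ln x / 2 + 1.
Proof.
move=> n_ge1 le_nx; have : Rle (INR n) x by apply/RleP; rewrite INRE.
have n_ge1' : le 1 n by lia.
move/(ln_floor_fact_upper n x n_ge1') => /RleP.
by rewrite !RealsE.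
Qed.

Lemma fact_lower n (x : R) : 2 <= x -> x <= n%:R + 1 ->
  x * ln x - x - ln x / 2 + 3 / 4 <= ln (n`!%:R).
Proof.
move=> x_ge2 le_xn; have h1 : Rle (IZR 2) x by apply/RleP; rewrite RealsE.
have : Rle x (Rplus (INR n) 1) by apply/RleP; rewrite !RealsE.
move/(ln_floor_fact_lower n x h1) => /RleP.
by rewrite !RealsE.
Qed.

Lemma IZRM (x y : Z) : IZR (x * y) = IZR x * IZR y.
Proof. exact: mult_IZR. Qed.

Lemma IZRD (x y : Z) : IZR (x + y) = IZR x + IZR y.
Proof. exact: plus_IZR. Qed.

Lemma IZR_nat (n : nat) (z : Z) : z = Z.of_nat n -> IZR z = n%:R :> R.
Proof. by move=> ->; rewrite natR_IZR. Qed.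

Lemma IZRN (x : Z) : IZR (- x) = - IZR x.
Proof. exact: opp_IZR. Qed.

Definition two17 : R := IZR 131072.

Lemma ln2_lower : 2 / 3 <= ln (2%:R : R).
Proof.
have : Rle (IZR 1) (IZR 2) by apply/IZR_le.
move/ln_ge_pade => /RleP; rewrite !RealsE => h.
rewrite (_ : nat_of_pos 2 = 2%N) // in h; apply: le_trans h.
by rewrite (_ : 2 + 1 = 3 :> R); [lra|ring].
Qed.

Lemma two17_gt0 : 0 < two17. Proof. exact: IZR_gt0. Qed.

Lemma log2_lowerR a b : log2_valid a b ->
  IZR (log2_lower 17 a b) * ln 2 <= two17 * (ln (IZR a) - ln (IZR b)).
Proof.
move=> valid; apply/RleP; have := log2_lower_correct 17 a b valid.
rewrite (_ : pow 2 17 = two17); last by rewrite pow_IZR.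
by rewrite !RealsE.
Qed.

(** Stirling's bound for one coefficient A, with l1 and l2 bounding lc and - lc from below in units
    of k. The case of a negative coefficient is given the same shape, so that all terms can be
    summed linearly. *)
Lemma term_core_pos (A c M k lc lm F l1 l2 N : R) :
  0 <= A -> 0 <= c -> 0 <= M -> 0 <= k -> F <= A * c * l1 ->
  l1 * k <= lc -> l2 * k <= - lc ->
  c * M * (lc + lm) - c * M - (lc + lm) / 2 + 3 / 4 <= N ->
  A * (c * M * (lm - 1)) + M * k * F - A * lm / 2 + k / 2 * (A * l2) + 3 * A / 4 <= A * N.
Proof.
move=> A_ge0 c_ge0 M_ge0 k_ge0 leF le1 le2 leN.
have h1 := ler_wpM2l A_ge0 leN.
have h2 := ler_wpM2l (mulr_ge0 M_ge0 k_ge0) leF.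
have h3 := ler_wpM2l (mulr_ge0 (mulr_ge0 A_ge0 c_ge0) M_ge0) le1.
have h4 := ler_wpM2l A_ge0 le2.
lra.
Qed.

Lemma term_core_neg (A c M k lc lm F l1 l2 N : R) :
  0 <= A -> 0 <= c -> 0 <= M -> 0 <= k -> F <= A * c * l1 ->
  l1 * k <= - lc -> l2 * k <= - lc ->
  N <= c * M * (lc + lm) - c * M + (lc + lm) / 2 + 1 ->
  - A * (c * M * (lm - 1)) + M * k * F - A * lm / 2 + k / 2 * (A * l2) + 4 * (- A) / 4 <= - A * N.
Proof.
move=> A_ge0 c_ge0 M_ge0 k_ge0 leF le1 le2 leN.
have h1 := ler_wpM2l A_ge0 leN.
have h2 := ler_wpM2l (mulr_ge0 M_ge0 k_ge0) leF.
have h3 := ler_wpM2l (mulr_ge0 (mulr_ge0 A_ge0 c_ge0) M_ge0) le1.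
have h4 := ler_wpM2l A_ge0 le2.
lra.
Qed.

Lemma term_lower x m : List.In x factorials -> (2000 <= m)%N ->
  IZR (snd x) * (ratio x * m%:R * (ln m%:R - 1)) +
  m%:R * (ln 2%:R / two17) * IZR (Z.abs (snd x) * numer x * log2_ratio x / denom x) -
  IZR (Z.abs (snd x)) * ln m%:R / 2 +
  ln 2%:R / two17 / 2 * IZR (Z.abs (snd x) * log2_lower 17 (denom x) (numer x)) +
  IZR (if 0 <=? snd x then 3 * snd x else 4 * snd x)%ZZ / 4 <=
  IZR (snd x) * ln ((scaled x m)`!%:R).
Proof.
move=> x_in m_ge; have [n_gt0 d_gt0 _] := factorials_wf x x_in.
have [valid valid' le_d] := factorials_log x x_in.
have nR := IZR_gt0 _ n_gt0; have dR := IZR_gt0 _ d_gt0.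
have m_gt0 : 0 < m%:R :> R by rewrite ltr0n (leq_trans _ m_ge).
have c_gt0 : 0 < ratio x by rewrite divr_gt0.
have c_ge : 1 <= 71%:R * ratio x.
  rewrite /ratio mulrA ler_pdivlMr // mul1r.
  by have := IZR_leP _ _ le_d; rewrite IZRM (IZR_nat 71 71%ZZ erefl).
(* 142 = 2 * 71: the lower Stirling bound asks for an argument of at least 2. *)
have X_ge2 : 2 <= ratio x * m%:R.
  have le142 : 142%:R <= m%:R :> R by rewrite ler_nat (leq_trans _ m_ge).
  have := ler_wpM2r (ltW m_gt0) c_ge; lra.
have /andP[lo hi] := floor_bounds (numer x * Z.of_nat m) _ d_gt0.
rewrite -Z_of_scaled // -natR_IZR IZRM -natR_IZR mulrAC -/(ratio x) lerBlDr in lo.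
rewrite -Z_of_scaled // -natR_IZR IZRM -natR_IZR mulrAC -/(ratio x) in hi.
have lnX : ln (ratio x * m%:R) = ln (IZR (numer x)) - ln (IZR (denom x)) + ln m%:R.
  rewrite lnM // /ratio lnM ?invr_gt0 //; congr (_ + _ + _).
  by apply: ln_Rinv; apply/RltP.
have lower := fact_lower _ _ X_ge2 lo.
have scaled_ge1 : (1 <= scaled x m)%N by rewrite -(ltr0n R); lra.
have upper := fact_upper _ _ scaled_ge1 hi.
rewrite lnX in lower upper.
have /andP[_ fl] := floor_bounds (Z.abs (snd x) * numer x * log2_ratio x) _ d_gt0.
have {}fl : IZR (Z.abs (snd x) * numer x * log2_ratio x / denom x) <=
    IZR (Z.abs (snd x)) * ratio x * IZR (log2_ratio x).
  by apply: le_trans fl _; rewrite !IZRM /ratio mulrA mulrAC lexx.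
have A_ge0 : 0 <= IZR (Z.abs (snd x)) by exact: IZR_leP (Z.abs_nonneg _).
have k_ge0 : 0 <= ln 2%:R / two17 by apply: divr_ge0 (ltW two17_gt0); have := ln2_lower; lra.
have bound a b : log2_valid a b ->
    IZR (log2_lower 17 a b) * (ln 2%:R / two17) <= ln (IZR a) - ln (IZR b).
  by move=> /log2_lowerR; rewrite mulrA ler_pdivrMr ?two17_gt0 // [two17 * _]mulrC.
have k1 := bound _ _ valid; have := bound _ _ valid'; rewrite -opprB => k2.
rewrite IZRM; move: fl; rewrite /log2_ratio; case: (Z.leb_spec 0 (snd x)) => [e_ge0|e_lt0] fl.
- rewrite Z.abs_eq // in A_ge0 fl *; rewrite IZRM (IZR_nat 3 3%ZZ erefl).
  exact: (term_core_pos _ _ _ _ _ _ _ _ _ _ A_ge0 (ltW c_gt0) (ltW m_gt0) k_ge0 fl k1 k2 lower).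
- have eA : Z.abs (snd x) = (- snd x)%ZZ by apply: Z.abs_neq; apply: Z.lt_le_incl.
  have eE : IZR (snd x) = - IZR (Z.abs (snd x)) by rewrite eA IZRN opprK.
  rewrite IZRM (IZR_nat 4 4%ZZ erefl) eE.
  exact: (term_core_neg _ _ _ _ _ _ _ _ _ _ A_ge0 (ltW c_gt0) (ltW m_gt0) k_ge0 fl k2 k2 upper).
Qed.

Lemma losses_total m : \sum_(x <- losses) IZR (snd x) * ((loss_index x m)%:R * ln 4%:R) <=
  m%:R * (2 * ln 2%:R) / two17 * IZR loss_term.
Proof.
have -> : ln (4%:R : R) = 2 * ln 2%:R by rewrite -(ln_natX 2 2).
have tR := two17_gt0; have L2 := ln2_lower.
rewrite /loss_term -IZR_sum mulr_sumr; apply: big_In_le => x x_in.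
have [S_gt0 _] := losses_before_horizon x x_in; have h_ge0 := losses_ge0 x x_in.
have SR := IZR_gt0 _ S_gt0; have {}h_ge0 : 0 <= IZR (snd x) by apply: (IZR_leP 0).
have /andP[fl _] := floor_bounds (snd x * time_unit * 131072) _ S_gt0.
rewrite IZRD; move: fl; rewrite lerBlDr => fl.
have idx := loss_index_le x m x_in.
move: (loss_index x m) time_unit fl idx => i tu fl idx.
have step : IZR (snd x) * i%:R <= m%:R / two17 *
    (IZR (snd x * tu * 131072 / fst x) + IZR 1).
  apply: le_trans (ler_wpM2l _ fl); last by rewrite divr_ge0 // ltW.
  rewrite !IZRM (_ : IZR 131072 = two17) //.
  have -> : m%:R / two17 * (IZR (snd x) * IZR tu * two17 / IZR (fst x)) =
    IZR (snd x) * (IZR tu * m%:R) / IZR (fst x) by field; rewrite !gt_eqF.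
  rewrite ler_pdivlMr // -mulrA ler_wpM2l // mulrC; exact: idx.
have -> : IZR (snd x) * (i%:R * (2 * ln 2%:R)) =
  2 * ln 2%:R * (IZR (snd x) * i%:R) by ring.
have -> : m%:R * (2 * ln 2%:R) / two17 * (IZR (snd x * tu * 131072 / fst x) + IZR 1) =
  2 * ln 2%:R * (m%:R / two17 * (IZR (snd x * tu * 131072 / fst x) + IZR 1)) by ring.
by rewrite ler_wpM2l //; lra.
Qed.

(** The 30 is half of the upper bound 60 for [balance]. *)
Lemma balance_term m : (2000 <= m)%N ->
  balance * (m%:R * (ln m%:R - 1)) - 30 * ln m%:R <= balance * ln (m`!%:R).
Proof.
move=> m_ge; have [bal_ge0 bal_le] := andP balance_bounds.
have m_ge2 : 2 <= m%:R :> R by rewrite ler_nat (leq_trans _ m_ge).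
have := fact_lower m _ m_ge2; rewrite lerDl ler01 => /(_ isT) h.
have lnm_ge0 : 0 <= ln (m%:R : R) by case: (m) m_ge => // m' _; apply: ln_nat_ge0.
have := ler_wpM2l bal_ge0 h.
have : balance * ln m%:R <= 60 * ln m%:R by rewrite ler_wpM2r.
by move: (ln _) (ln _) (balance) bal_ge0 => a b c *; lra.
Qed.

Lemma zsum_linear (T : Type) (b : T -> R) (f1 f2 f3 f4 : T -> Z) (s : list T) (c1 c2 c3 : R) :
  \sum_(x <- s) b x + c1 * IZR (zsum f1 s) - IZR (zsum f2 s) * c2 / 2 + c3 * IZR (zsum f3 s) +
    IZR (zsum f4 s) / 4 =
  \sum_(x <- s) (b x + c1 * IZR (f1 x) - IZR (f2 x) * c2 / 2 + c3 * IZR (f3 x) + IZR (f4 x) / 4).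
Proof.
rewrite -!IZR_sum !mulr_suml !mulr_sumr -sumrN -!big_split.
by apply: eq_bigr => x _ /=.
Qed.

Lemma terms_sum m : (2000 <= m)%N ->
  - (balance * (m%:R * (ln m%:R - 1))) + m%:R * (ln 2%:R / two17) * IZR main_term -
  IZR weight * ln m%:R / 2 + ln 2%:R / two17 / 2 * IZR log_term + IZR constant_term / 4 <=
  \sum_(x <- factorials) IZR (snd x) * ln ((scaled x m)`!%:R).
Proof.
move=> m_ge.
apply: le_trans (big_In_le _ _ _ _ (fun x x_in => term_lower x m x_in m_ge)).
rewrite -zsum_linear -/main_term -/weight -/log_term -/constant_term !lerD2r.
rewrite /balance mulNr opprK mulr_suml le_eqVlt; apply/orP; left; apply/eqP.
by apply: eq_bigr => x _; rewrite !mulrA.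
Qed.

Lemma content_large m K : (2000 <= m)%N -> (53 * m < K)%N ->
  ((5971 * INR m + 51000) * ln 2 <= 1000 * ln (INR (content (23 * m) (13 * m) (53 * m) K)))%RR.
Proof.
move=> m_ge lt_K; have tR := two17_gt0.
have main := le_trans (lerD (terms_sum m m_ge) (balance_term m m_ge)) (content_lower m K lt_K).
have loss := losses_total m.
have [eM eL eW eG eC] := certificate_terms.
have M_ge : Rle (IZR 2000) (INR m).
  by rewrite INR_IZR_INZ; apply: IZR_le; have := m_ge; lia.
rewrite eM eW eL {eM eL eW} in main loss.
rewrite eG eC {eG eC} in main.
apply: (content_rate _ (ln 2%:R) (balance * (m%:R * (ln m%:R - 1))) (ln m%:R) _
  (\sum_(x <- losses) IZR (snd x) * ((loss_index x m)%:R * ln 4%:R)) _ _ M_ge).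
- by rewrite (IZR_nat 2 2%ZZ erefl).
- by rewrite INRE.
- apply/RleP; move: main; rewrite !(RplusE, RminusE, RmultE, RdivE, RoppE, INRE, IZR_nat 2 2%ZZ erefl,
    IZR_nat 4 4%ZZ erefl, IZR_nat 60 60%ZZ erefl, IZR_nat 30 30%ZZ erefl).
  by rewrite -/two17 (_ : IZR 1 = 1).
- apply/RleP; move: loss; rewrite !(RplusE, RmultE, RdivE, INRE, IZR_nat 2 2%ZZ erefl).
  by rewrite -/two17.
Qed.

(** ** Conclusion *)

Definition realE := (RplusE, RmultE, INRE).

Lemma content_gt0 l n N K : (0 < content l n N K)%N.
Proof. by apply: prodn_cond_gt0 => p p_pr; rewrite expn_gt0 prime_gt0. Qed.

Lemma nat_sum_split (a b c : nat) : (a <= b + c)%N -> (a <= 2 * b)%N \/ (a <= 2 * c)%N.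
Proof. by move=> h; case: (leqP c b) => h'; [left|right]; lia. Qed.

(** One of the two terms bounding 9 ^ M * W is at least half of it; each of the two hypotheses on W
    rules out one case. *)
Lemma large_content_no_approximation (m r : nat) (X s : int) :
  let W := content (23 * m) (13 * m) (53 * m) (53 * m).+1 in
  (0 < m)%N -> (4 ^ (60 * m + r))%:Z = (3 ^ (60 * m + r))%:Z * X + s ->
  0 < (-1) ^+ (23 * m) * s -> (`|s| * 3 ^ (60 * m + r) <= 4 ^ (60 * m + r))%N ->
  ((5971 * INR m + 416 * INR r + 1000) * ln 2 <= 1000 * ln (INR W))%RR ->
  ((5780 * INR m + 2000 * INR r + 1000) * ln 2 <= 1000 * ln (INR W))%RR ->
  False.
Proof.
move=> W m_gt0 approx s_pos s_small largeQ largeR.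
have W_gt0 : (0 < W)%N := content_gt0 _ _ _ _.
have dvdQ i : (i <= 13 * m)%N -> (W %| 'C(23 * m + 30 * m, i) * 'C(23 * m + 13 * m - i, 23 * m))%N.
  by move=> le_i; rewrite -mulnDl; apply: content_dvdn; lia.
have dvdP j : (j <= 23 * m)%N -> (W %| 'C(23 * m + 13 * m - j, 13 * m) * 'C(23 * m + 30 * m, j))%N.
  move=> le_j; rewrite [('C(_, _) * _)%N]mulnC -mulnDl [(23 * m + 13 * m)%N]addnC /W content_sym.
  by apply: content_dvdn; lia.
have split_pow : (4 ^ (2 * (30 * m) + r))%:Z = (9 ^ (30 * m))%:Z * ((3 ^ r)%:Z * X) + s.
  rewrite mulnA approx expnD (_ : 60 * m = 2 * (30 * m))%N; last by lia.
  by rewrite expnM PoszM -!mulrA.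
have := pade_lower_bound W (23 * m) (13 * m) (30 * m) r _ s _ _ dvdQ dvdP split_pow s_pos.
rewrite -[(23 * m + 30 * m)%N]mulnDl -[(23 + 30)%N]/53%N.
have mP : Rlt 0 (INR m) by apply: lt_0_INR; lia.
have rP : Rle 0 (INR r) := pos_INR r.
move=> /(_ ltac:(lia) ltac:(lia)) /nat_sum_split[] hW.
- have s_gt0 : (0 < `|s|)%N by rewrite absz_gt0; apply/eqP => s0; rewrite s0 mulr0 ltxx in s_pos.
  have Q_gt0 : (0 < padeQ (23 * m) (13 * m) (53 * m))%N by apply: padeQ_gt0; lia.
  have hQ := padeQ_upper 8 17 (23 * m) (13 * m) (53 * m) ltac:(lia).
  have {hW} := ln_nat_le _ _ _ hW; have {hQ} := ln_nat_le _ _ _ hQ.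
  have {s_small} := ln_nat_le _ _ _ s_small.
  rewrite (_ : 8 * (8 + 17) + 8 = 208)%N // (_ : 8 * (8 + 17) = 200)%N // (_ : 8 + 17 = 25)%N //.
  rewrite (_ : 53 * m - 13 * m = 40 * m)%N; last by lia.
  rewrite !(muln_gt0, expn_gt0) ?s_gt0 ?Q_gt0 ?W_gt0 /= => /(_ isT) hS /(_ isT) hQ /(_ isT) hW.
  rewrite !(ln_natM, ln_natX, muln_gt0, expn_gt0, s_gt0, Q_gt0, W_gt0) // in hS hQ hW.
  rewrite !natrM in hQ hW; rewrite natrD natrM in hS.
  apply: (main_term_too_small (INR m) (INR r) _ (ln (padeQ (23 * m) (13 * m) (53 * m))%:R)
    (ln `|s|%:R) mP rP largeQ).
  + apply/RleP; move: hW; rewrite !(realE, IZR_nat 2 2%ZZ erefl, IZR_nat 9 9%ZZ erefl,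
      IZR_nat 30 30%ZZ erefl) //.
  + apply/RleP; move: hS; rewrite !(realE, IZR_nat 3 3%ZZ erefl, IZR_nat 4 4%ZZ erefl,
      IZR_nat 60 60%ZZ erefl) //.
  + apply/RleP; move: hQ; rewrite !(realE, IZR_nat 17 17%ZZ erefl, IZR_nat 8 8%ZZ erefl,
      IZR_nat 200 200%ZZ erefl, IZR_nat 25 25%ZZ erefl, IZR_nat 208 208%ZZ erefl,
      IZR_nat 23 23%ZZ erefl, IZR_nat 13 13%ZZ erefl, IZR_nat 40 40%ZZ erefl,
      IZR_nat 53 53%ZZ erefl) //.
- have := largeR.
  have hR := padeR_upper 1 18 (23 * m) (13 * m) (53 * m) ltac:(lia).
  have R_gt0 : (0 < padeR (23 * m) (13 * m) (53 * m))%N.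
    rewrite lt0n; apply/eqP => R0; move: hW; rewrite R0 !muln0 leqn0 muln_eq0.
    by rewrite expn_eq0 /= => /eqP W0; rewrite W0 in W_gt0.
  have {hW} := ln_nat_le _ _ _ hW; have {hR} := ln_nat_le _ _ _ hR.
  rewrite (_ : 8 * 1 + (1 + 18) = 27)%N // (_ : 1 + 18 = 19)%N // exp1n muln1.
  rewrite !(muln_gt0, expn_gt0) ?R_gt0 ?W_gt0 /= => /(_ isT) hR /(_ isT) hW.
  rewrite !(ln_natM, ln_natX, muln_gt0, expn_gt0, R_gt0, W_gt0) // in hR hW.
  rewrite -[(13 * m).+1]addn1 natrD !natrM in hR; rewrite !natrM in hW.
  move=> /(remainder_too_small (INR m) (INR r) _ (ln (padeR (23 * m) (13 * m) (53 * m))%:R) mP); apply.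
  + apply/RleP; move: hW; rewrite !(realE, IZR_nat 2 2%ZZ erefl, IZR_nat 9 9%ZZ erefl,
      IZR_nat 30 30%ZZ erefl, IZR_nat 4 4%ZZ erefl) //.
  + apply/RleP; move: hR; rewrite !(realE, IZR_nat 18 18%ZZ erefl, IZR_nat 19 19%ZZ erefl,
      IZR_nat 23 23%ZZ erefl, IZR_nat 13 13%ZZ erefl, IZR_nat 27 27%ZZ erefl,
      IZR_nat 53 53%ZZ erefl) //.
Qed.

(** * The enumerated primes as divisors of the content *)

Lemma mem_In (T : eqType) (x : T) (s : seq T) : x \in s -> List.In x s.
Proof. by elim: s => //= a s IH; rewrite inE => /orP[/eqP->|/IH]; [left|right]. Qed.

Lemma primes_below_231_complete q : (q < 231)%N -> prime q -> List.In q primes_below_231.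
Proof.
move=> lt_q q_pr.
have q_in : q \in iota 0 231 by rewrite mem_iota.
have /allP/(_ q q_in)/implyP/(_ q_pr) :
  all (fun q => prime q ==> (q \in primes_below_231)) (iota 0 231) by vm_compute.
exact: mem_In.
Qed.

#[local] Opaque prime_table primes_below_231.

Lemma prime_table_prime x : List.In x prime_table -> prime (Z.to_nat (fst x)).
Proof.
move=> /(proj2 prime_table_spec)[_ [i [-> [lt_i all_q]]]].
have -> : Z.to_nat (231 + Z.of_nat i)%ZZ = (231 + i)%N by lia.
have [//|] := ltnP (231 + i) (pdiv (231 + i) ^ 2); first by apply: ltn_pdiv2_prime; rewrite addn_gt0.
have pr : prime (pdiv (231 + i)) by rewrite pdiv_prime // ltn_addr.
move: (pdiv _) pr (pdiv_dvd (231 + i)) => d d_pr /dvdnP[c e] le_d2.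
(* A least prime factor d >= 231 would give 231 + i >= 231 ^ 2 = 53361, beyond the end of the
   table. *)
have lt_d : (d < 231)%N by rewrite ltnNge; apply/negP => le_d; nia.
have := all_q d (primes_below_231_complete _ lt_d d_pr).
by case; apply/Nat.Div0.mod_divides; exists c; rewrite mulnC in e; exact: e.
Qed.

Lemma Z_of_modn (a d : nat) : (0 < d)%N -> Z.of_nat (a %% d) = (Z.of_nat a mod Z.of_nat d)%ZZ.
Proof.
move=> d_gt0; rewrite {2}(divn_eq a d) Nat2Z.inj_add Nat2Z.inj_mul Z.add_comm Z_mod_plus_full.
by rewrite Z.mod_small //; have := ltn_pmod a d_gt0; lia.
Qed.

Lemma good_prime_content_at m p : (0 < p)%N -> good_prime (Z.of_nat m) (Z.of_nat p) ->
  content_at (23 * m) (13 * m) (53 * m) p.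
Proof.
move=> p_gt0; rewrite /good_prime /content_at.
have E a : ((Z.of_nat a * Z.of_nat m) mod Z.of_nat p)%ZZ = Z.of_nat (a * m %% p)%N.
  by rewrite Z_of_modn // Nat2Z.inj_mul.
by have := E 53%N; have := E 23%N; have := E 13%N => /= -> -> ->; lia.
Qed.

Lemma content_at_le l n N q : (l + n <= N)%N -> (0 < q)%N -> content_at l n N q -> (q <= N)%N.
Proof.
rewrite /content_at => le_N q_gt0; case: (leqP q N) => // lt_N; rewrite (modn_small lt_N).
have := leq_mod l q; have := leq_mod n q; lia.
Qed.

Lemma sum_ln_le_content l n N (s : seq nat) : uniq s -> (l + n <= N)%N ->
  {in s, forall p, prime p && content_at l n N p} ->
  \sum_(p <- s) ln (p%:R) <= ln ((content l n N N.+1)%:R : R).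
Proof.
move=> s_uniq le_N s_good.
have s_le p : p \in s -> (p < N.+1)%N.
  by move=> /s_good/andP[p_pr]; rewrite ltnS; apply: content_at_le; rewrite ?prime_gt0.
rewrite /content (ln_prod_prime_powers N.+1 (fun p => \sum_(1 <= k < N.+1) content_at l n N (p ^ k))%N).
have -> : \sum_(p <- s) ln (p%:R : R) = \sum_(p < N.+1 | prime p && ((p : nat) \in s)) ln (p%:R : R).
  rewrite -(big_mkord (fun p => prime p && (p \in s)) (fun p => ln (p%:R : R))) -[RHS]big_filter.
  apply: perm_big; apply: uniq_perm => // [|p]; first by rewrite filter_uniq // iota_uniq.
  rewrite mem_filter mem_index_iota; apply/idP/idP => [p_in|/andP[/andP[]]//].
  by rewrite p_in s_le //; have /andP[->] := s_good p p_in.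
rewrite big_mkcondr; apply: ler_sum => p p_pr.
have p_gt0 := prime_gt0 p_pr.
have lnp_ge0 : 0 <= ln ((p : nat)%:R : R) by move: p_gt0; case: (p : nat) => // q _; exact: ln_nat_ge0.
case: ifP => [/s_good/andP[_ good]|_]; last by rewrite mulr_ge0.
rewrite -[leLHS]mul1r ler_wpM2r // ler1n.
have N_gt0 : (1 < N.+1)%N by rewrite ltnS (leq_trans p_gt0) // -ltnS ltn_ord.
by rewrite big_ltn // expn1 good.
Qed.

Lemma NoDup_uniq (T : eqType) (s : seq T) : List.NoDup s -> uniq s.
Proof.
elim=> //= x {}s notin_x _ ->; rewrite andbT; apply/negP => /mem_In; apply: notin_x.
Qed.

Lemma good_primes_content m : (0 < m)%N ->
  (IZR (total_weight (good_primes (Z.of_nat m) windows prime_table)) * ln 2 <=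
   128 * ln (INR (content (23 * m) (13 * m) (53 * m) (53 * m).+1)))%RR.
Proof.
move=> m_gt0; have [inc table] := prime_table_spec.
have pos x : List.In x prime_table -> (0 < fst x)%ZZ by move=> /table[_ [i [-> _]]]; lia.
have m_pos : (0 < Z.of_nat m)%ZZ by lia.
have [nodup spec] := good_primes_spec _ _ m_pos inc pos.
move: (good_primes _ _ _) nodup spec => L nodup spec.
apply: Rle_trans (total_weight_le L _) _; first by move=> x /spec[/table[]].
apply: Rmult_le_compat_l; first by apply: IZR_le.
pose key (x : Z * Z) := Z.to_nat (fst x).
have -> : List.fold_right (fun x => Rplus (ln (IZR (fst x)))) (IZR 0) L =
    \sum_(p <- map key L) ln (p%:R : R).
  rewrite big_map; elim: L {nodup} spec => [|x L IH] spec; first by rewrite big_nil.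
  rewrite big_cons -IH; last by move=> y y_in; apply: spec; right.
  have [/pos x_pos _] := spec x (or_introl erefl).
  by rewrite natR_IZR /key Z2Nat.id //; lia.
rewrite INRE; apply/RleP; apply: sum_ln_le_content; last first.
- move=> p /mem_In/List.in_map_iff[x [<- x_in]].
  have [in_table good] := spec x x_in.
  rewrite /key prime_table_prime //=; apply: good_prime_content_at; have := pos x in_table; first lia.
  by move=> x_pos; rewrite Z2Nat.id //; lia.
- by rewrite -mulnDl leq_mul2r orbT.
apply: NoDup_uniq.
have -> : map key L = List.map Z.to_nat (List.map fst L) by rewrite List.map_map.
apply: List.NoDup_map_NoDup_ForallPairs (nodup) => a b /List.in_map_iff[x [<- /spec[/pos x_pos _]]].
by move=> /List.in_map_iff[y [<- /spec[/pos y_pos _]]]; lia.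
Qed.

(* The three ranges of exponents *)
#[local] Opaque prime_table windows cuts walk far_ranges.

Lemma not_multiple_of_pow3 k (X : Z) : (0 < k)%N -> (4 ^ Z.of_nat k <> 3 ^ Z.of_nat k * X)%ZZ.
Proof.
move=> k_gt0 e; have : ((4 ^ Z.of_nat k) mod 3 = 0)%ZZ.
  rewrite e -(prednK k_gt0) Nat2Z.inj_succ Z.pow_succ_r; last by lia.
  by rewrite -Z.mul_assoc Z.mul_comm Z_mod_mult.
by rewrite Zpower_mod // Z.pow_1_l //; lia.
Qed.

(** Besides k = 60 q + r there is k = 60 (q - 1) + (60 + r), and one of q, q - 1 has the prescribed
    parity; starting from 2001 keeps m >= 2000. *)
Lemma divide_by_60_with_parity k : (60 * 2001 <= k)%N -> forall b : bool,
  exists m r, [/\ k = 60 * m + r, 2000 <= m, r < 120 & odd m = b]%N.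
Proof.
move=> k_ge b; have := divn_eq k 60; have := ltn_pmod k (isT : 0 < 60)%N.
have := leq_div2r 60 k_ge; rewrite mulKn //.
move: (k %/ 60)%N (k %% 60)%N => [//|q] r q_ge lt_r ek.
have [<-|ne] := eqVneq (odd q.+1) b.
- by exists q.+1, r; split=> //; [rewrite mulnC|apply: ltnW|apply: ltn_trans lt_r _].
- exists q, (60 + r)%N; split=> //; last by move: ne; rewrite oddS; case: (odd q) b => [] [].
  by rewrite ek mulSn [(q * 60)%N]mulnC addnAC addnC addnA.
Qed.

(** l = 23 m has the parity of m, so the parity condition makes (-1) ^ l * s positive; s is nonzero
    because 4 ^ k is prime to 3. *)
Lemma no_approximation_of_content (m r : nat) (X s : Z) :
  let k := (60 * m + r)%N in let W := content (23 * m) (13 * m) (53 * m) (53 * m).+1 in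
  (0 < m)%N -> (4 ^ Z.of_nat k = 3 ^ Z.of_nat k * X + s)%ZZ ->
  (Z.abs s * 3 ^ Z.of_nat k <= 4 ^ Z.of_nat k)%ZZ -> odd m = (s <? 0)%ZZ ->
  ((5971 * INR m + 416 * INR r + 1000) * ln 2 <= 1000 * ln (INR W))%RR ->
  ((5780 * INR m + 2000 * INR r + 1000) * ln 2 <= 1000 * ln (INR W))%RR ->
  False.
Proof.
move=> k W m_gt0 approx small odd_m.
apply: (large_content_no_approximation m r (ssrZ.int_of_Z X) (ssrZ.int_of_Z s) m_gt0).
- by move: approx; rewrite -/k; lia.
- have s_neq0 : s <> Z0.
    move=> s0; apply: (not_multiple_of_pow3 k X); last by rewrite approx s0 Z.add_0_r.
    by rewrite addn_gt0 muln_gt0 m_gt0.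
  rewrite -signr_odd oddM odd_m; case: Z.ltb_spec => h; rewrite ?expr1 ?expr0; lia.
- by move: small; rewrite -/k; lia.
Qed.

Lemma no_approximation_large k (X s : Z) : (60 * 2001 <= k)%N ->
  (4 ^ Z.of_nat k = 3 ^ Z.of_nat k * X + s)%ZZ -> (Z.abs s * 3 ^ Z.of_nat k <= 4 ^ Z.of_nat k)%ZZ ->
  False.
Proof.
move=> k_ge; have [m [r [-> m_ge lt_r odd_m]]] := divide_by_60_with_parity k k_ge (s <? 0)%ZZ.
move=> approx small.
have := content_large m _ m_ge (ltnSn _) => hW.
have rP : Rle (INR r) (IZR 119) by rewrite INR_IZR_INZ; apply: IZR_le; lia.
have mP : Rle (IZR 2000) (INR m) by rewrite INR_IZR_INZ; apply: IZR_le; move: m_ge; lia.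
have [hQ hR] := content_margins _ _ _ rP mP hW.
by apply: (no_approximation_of_content m r X s) hQ hR => //; apply: leq_trans m_ge.
Qed.

Lemma no_approximation_middle k (X s : Z) : (60 * 128 <= k < 60 * 2001)%N ->
  (4 ^ Z.of_nat k = 3 ^ Z.of_nat k * X + s)%ZZ -> (Z.abs s * 3 ^ Z.of_nat k <= 4 ^ Z.of_nat k)%ZZ ->
  False.
Proof.
move=> /andP[k_ge k_lt].
(* The walk keeps the parity of its start: odd for negative s, even otherwise. *)
have [m0 [m0P walk_m0]] : exists m0, (m0 = 127 /\ (s <? 0) \/ m0 = 128 /\ (s <? 0) = false)%ZZ /\
    walk 200 prime_table m0.
  case: (s <? 0)%ZZ.
  - by exists 127%ZZ; split; [left|exact: walk_from_127].
  - by exists 128%ZZ; split; [right|exact: walk_from_128].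
have k_range : (60 * m0 <= Z.of_nat k < 120060)%ZZ by clear walk_m0; lia.
have [m [j [r [em [j_ge [ek r_range]]]]]] := walk_covers _ _ _ _ walk_m0 k_range.
have {walk_m0} m_ge : (127 <= m)%ZZ by lia.
pose m' := Z.to_nat m; pose r' := Z.to_nat r.
have em' : Z.of_nat m' = m by rewrite Z2Nat.id //; lia.
have er' : Z.of_nat r' = r by rewrite Z2Nat.id //; lia.
have ek' : k = (60 * m' + r')%N by lia.
have m'_gt0 : (0 < m')%N by lia.
have := good_primes_content m' m'_gt0; rewrite em' => hW.
have [] := reach_bounds m _ r _ (proj2 r_range) hW; rewrite -em' -er' -!INR_IZR_INZ => hQ hR.
rewrite ek' => approx small; apply: (no_approximation_of_content m' r' X s) hQ hR => //.
clear hW r_range; move: m0P; case: (s <? 0)%ZZ => m0P; lia.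
Qed.

Lemma no_integer_approximation (k : nat) (X s : Z) : le 6 k ->
  (4 ^ Z.of_nat k = 3 ^ Z.of_nat k * X + s)%ZZ -> (Z.abs s * 3 ^ Z.of_nat k <= 4 ^ Z.of_nat k)%ZZ ->
  False.
Proof.
move=> /ssrnat.leP k_ge; have [lt_k|ge_k] := ltnP k (60 * 128).
- apply: (far_ranges_exclude _ _ _ _ _ far_ranges_hold); lia.
- have [lt_k|] := ltnP k (60 * 2001); last exact: no_approximation_large.
  by apply: no_approximation_middle; rewrite ge_k.
Qed.

End Approximation.

Open Scope R_scope.

Theorem theorem1 : forall k : nat, (6 <= k)%nat ->
  dist_Z ((4/3) ^ k) > (4/9) ^ k.
Proof.
intros k k_ge.
assert (far : forall n : Z, (4/9) ^ k < Rabs ((4/3) ^ k - IZR n)).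
  intros n; apply Rnot_le_lt; intros close.
  (* Clearing denominators: |s| = 3 ^ k * |(4/3) ^ k - n| is at most 3 ^ k * (4/9) ^ k = 4 ^ k / 3 ^
     k. *)
  set (s := (4 ^ Z.of_nat k - 3 ^ Z.of_nat k * n)%Z).
  apply (Approximation.no_integer_approximation k n s k_ge); [unfold s; lia|].
  assert (p3 : 0 < 3 ^ k) by (apply pow_lt; lra).
  apply le_IZR; rewrite mult_IZR, abs_IZR; unfold s.
  rewrite minus_IZR, mult_IZR, <- !pow_IZR.
  replace (4 ^ k) with ((4/9) ^ k * 3 ^ k * 3 ^ k) at 2.
    apply Rmult_le_compat_r; [lra|].
    replace (4 ^ k - 3 ^ k * IZR n) with (((4/3) ^ k - IZR n) * 3 ^ k).
      rewrite Rabs_mult, (Rabs_pos_eq (3 ^ k)) by lra.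
      apply Rmult_le_compat_r; lra.
    rewrite Rmult_minus_distr_r, <- Rpow_mult_distr; replace (4 / 3 * 3) with 4 by field; ring.
  rewrite <- !Rpow_mult_distr; f_equal; field.
apply Rmin_glb_lt; apply far.
Qed.
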